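(* Let $n\ge3$, $\alpha\ge0$, let $v\in h^2(\mathbb{R}^n_+)$ and let $x$ be an arbitrary point in $\mathbb{R}^n_+$. The sharp coefficient $\mathcal{C}_{\alpha,n,2}(x)$ in the inequality $$\left|\nabla\big(x_n^{n\alpha-1}v(x)\big)\right|\le\mathcal{C}_{\alpha,n,2}(x)\,\|v\|_2$$ is given by $$\mathcal{C}_{\alpha,n,2}(x)=C_{\alpha,n,2}\,x_n^{\,n\alpha-(n+3)/2},$$ where $$C_{\alpha,n,2}=\left\{\frac{n}{2^{n-2}\omega_n}\left(n\alpha^2-(n+1)\alpha+\frac{n+3}{4}\right)\right\}^{1/2}$$ if $$0\le\alpha\le\frac12\quad\text{or}\quad\alpha\ge\frac12+\frac1n,\qquad( * )$$ and $$C_{\alpha,n,2}=\left\{\frac{n}{2^{n}\omega_n}\right\}^{1/2}$$ if $$\frac12<\alpha<\frac12+\frac1n.$$ In particular, $$C_{1,n,2}=\left\{\frac{n(n-1)}{2^{n}\omega_n}\right\}^{1/2}.$$ If $\alpha$ satisfies condition $( * )$, then the coefficient $\mathcal{C}_{\alpha,n,2}(x)$ is sharp also in the weaker inequality obtained by replacing $\nabla(x_n^{n\alpha-1}v)$ by $\partial(x_n^{n\alpha-1}v)/\partial x_n$.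
   Context: $\mathbb{R}^n_+=\{x=(x',x_n):x'\in\mathbb{R}^{n-1},\ x_n>0\}$; $\omega_n=2\pi^{n/2}/\Gamma(n/2)$. $h^2(\mathbb{R}^n_+)$ is the space of (real) harmonic functions on $\mathbb{R}^n_+$ representable as the Poisson integral $v(x)=\frac{2}{\omega_n}\int_{\mathbb{R}^{n-1}}\frac{x_n}{|y-x|^n}v(y')\,dy'$, $y=(y',0)$, with boundary values $v(y')$ in $L^2(\mathbb{R}^{n-1})$; $\|v\|_2$ is the $L^2(\mathbb{R}^{n-1})$-norm of the boundary values. ''Sharp coefficient'' at a given $x$ means the smallest one for which the inequality holds for all $v\in h^2(\mathbb{R}^n_+)$. *)

(* Defs.v *)
From HB Require Import structures.
From mathcomp Require Import all_boot all_order all_algebra.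
From mathcomp Require Import all_classical all_reals all_analysis.

Set Implicit Arguments.
Unset Strict Implicit.
Unset Printing Implicit Defensive.
Import Order.TTheory GRing.Theory Num.Theory.
Import numFieldNormedType.Exports.

Local Open Scope classical_set_scope.
Local Open Scope ring_scope.

Section cons_measure.
Local Open Scope ereal_scope.
Context d (T : measurableType d) (R : realType) (k : nat).
Variable m1 : {sigma_finite_measure set T -> \bar R}.
Variable m2 : {sigma_finite_measure set (k.-tuple T) -> \bar R}.

Definition cons_pair (z : T * k.-tuple T) : k.+1.-tuple T :=
  [the k.+1.-tuple T of z.1 :: z.2].

Lemma measurable_cons_pair : measurable_fun [set: T * k.-tuple T] cons_pair.
Proof.
by apply: measurable_cons; [exact: measurable_fst|exact: measurable_snd].
Qed.

(* The product measure of m1 and m2, carried over to the tuples of size k.+1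
   by the identification of T * T^k with T^(k.+1). *)
Definition cons_measure : set (k.+1.-tuple T) -> \bar R :=
  pushforward (m1 \x m2) cons_pair.

Let mpre (A : set (k.+1.-tuple T)) :
  measurable A -> measurable (cons_pair @^-1` A).
Proof.
by move=> mA; rewrite -[X in measurable X]setTI; exact: measurable_cons_pair.
Qed.

Let cons_measure0 : cons_measure set0 = 0.
Proof. by rewrite /cons_measure /pushforward preimage_set0 measure0. Qed.

Let cons_measure_ge0 A : 0 <= cons_measure A.
Proof. by rewrite /cons_measure /pushforward measure_ge0. Qed.

Let cons_measure_sigma_additive : semi_sigma_additive cons_measure.
Proof.
move=> F mF tF mUF; rewrite /cons_measure /pushforward preimage_bigcup.
apply: measure_semi_sigma_additive.
- by move=> i; exact: mpre.
- apply/trivIsetP => /= i j _ _ ij; rewrite -preimage_setI.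
  by move/trivIsetP : tF => /(_ _ _ _ _ ij) ->//; rewrite preimage_set0.
- by rewrite -preimage_bigcup; exact: mpre.
Qed.

HB.instance Definition _ := isMeasure.Build _ _ _ cons_measure
  cons_measure0 cons_measure_ge0 cons_measure_sigma_additive.

Let cons_measure_sigma_finite : sigma_finite setT cons_measure.
Proof.
have /sigma_finiteP[F [TF ndF Foo]] := sigma_finiteT m1.
have /sigma_finiteP[G [TG ndG Goo]] := sigma_finiteT m2.
pose uncons (t : k.+1.-tuple T) : T * k.-tuple T :=
  (thead t, [tuple of behead t]).
have muncons : measurable_fun setT uncons.
  apply/measurable_fun_pairP; split; first exact: measurable_tnth.
  exact: measurable_behead.
have consK : cancel cons_pair uncons.
  by move=> [x t]; congr pair; exact/val_inj.
exists (fun i => uncons @^-1` (F i `*` G i)).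
  apply/seteqP; split=> // t _.
  have [i _ Fi] : (\bigcup_i F i) (uncons t).1 by rewrite -TF.
  have [j _ Gj] : (\bigcup_j G j) (uncons t).2 by rewrite -TG.
  exists (maxn i j) => //=; split.
    by have /subsetPset := ndF _ _ (leq_maxl i j); exact.
  by have /subsetPset := ndG _ _ (leq_maxr i j); exact.
move=> i; have [mF Fi] := Foo i; have [mG Gi] := Goo i.
have mFG := measurableX mF mG; split.
  by rewrite -[X in measurable X]setTI; exact: muncons.
rewrite /cons_measure /pushforward -comp_preimage.
rewrite (_ : uncons \o cons_pair = id); last first.
  by apply/funext => z; exact: consK.
by rewrite preimage_id product_measure1E// lte_mul_pinfty// ge0_fin_numE.
Qed.

HB.instance Definition _ := Measure_isSigmaFinite.Build _ _ _ cons_measure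
  cons_measure_sigma_finite.

End cons_measure.

(* Lebesgue measure on the Borel sets of R^k, points of R^k being tuples. *)
Fixpoint lebesgue_tuple (R : realType) (k : nat) :
    {sigma_finite_measure set (k.-tuple (measurableTypeR R)) -> \bar R} :=
  match k with
  | 0 => dirac [tuple]
  | k'.+1 => cons_measure lebesgue_measure (lebesgue_tuple R k')
  end.

Lemma lebesgue_tuple_box (R : realType) (k : nat)
    (A : 'I_k -> set (measurableTypeR R)) :
  (forall i, measurable (A i)) ->
  lebesgue_tuple R k [set t | forall i, A i (tnth t i)] =
  (\prod_(i < k) lebesgue_measure (A i))%E.
Proof.
elim: k A => [|k IH] A mA.
  rewrite big_ord0 /= /dirac indicE mem_set//.
  by case.
rewrite big_ord_recl -(IH (fun i => A (lift ord0 i)))//.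
rewrite -product_measure1E //; last first.
  rewrite (_ : [set _ | _] =
      \bigcap_(i in [set: 'I_k]) ((fun t => tnth t i) @^-1` A (lift ord0 i))).
    apply: fin_bigcap_measurable; first exact: finite_finset.
    move=> i _; rewrite -[X in measurable X]setTI.
    exact: (measurable_tnth i).
  by apply/seteqP; split=> t /= h i => [_|]; exact: h.
rewrite /= /cons_measure /pushforward; congr (product_measure1 _ _ _).
apply/seteqP; split=> -[x t] /=.
  move=> h; split; first exact: (h ord0).
  by move=> i; have := h (lift ord0 i); rewrite tnthS.
move=> [hx ht] i; have [->//|] := eqVneq i ord0.
by rewrite eq_sym => /unlift_some[j -> _]; rewrite tnthS.
Qed.

Section half_space.
Context {R : realType}.

Definition Gamma (s : R) : R :=
  \int[lebesgue_measure]_(t in `]0, +oo[%classic) (t `^ (s - 1) * expR (- t)).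

(* The area of the unit sphere of R^n. *)
Definition omega (n : nat) : R := 2 * pi `^ (n%:R / 2) / Gamma (n%:R / 2).

(* The ambient space R^n is 'rV[R]_m.+1 with n = m.+1, the last coordinate x_n
   being [x 0 ord_max]; the boundary R^(n-1) is m.-tuple (measurableTypeR R),
   which carries the Borel sigma-algebra. *)
Context {m : nat}.
Local Notation point := 'rV[R]_m.+1.
Local Notation bdry := (m.-tuple (measurableTypeR R)).
Implicit Types (x : point) (f v : point -> R) (g : bdry -> R).

Definition half_space : set point := [set x | 0 < x 0 ord_max].

(* Row vectors carry the sup norm in the library. *)
Definition enorm x : R := Num.sqrt (\sum_i x 0 i ^+ 2).

Definition partial (i : 'I_m.+1) f : point -> R := 'D_(delta_mx 0 i) f.

Definition grad f x : point := \row_i partial i f x.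

Definition C2_on (U : set point) f : Prop := forall x, U x -> forall i j,
  [/\ derivable f x (delta_mx 0 i),
      {for x, continuous (partial i f)},
      derivable (partial j f) x (delta_mx 0 i) &
      {for x, continuous (partial i (partial j f))}].

Definition harmonic_on (U : set point) f : Prop :=
  C2_on U f /\ forall x, U x -> \sum_i partial i (partial i f) x = 0.

(* (y', 0): entry m, beyond the end of the tuple, takes the default value 0. *)
Definition bdry_point (y : bdry) : point := \row_i nth 0 y i.

Definition poisson_integral g x : R :=
  2 / omega m.+1 *
  \int[lebesgue_tuple R m]_y
     (x 0 ord_max / enorm (bdry_point y - x) ^+ m.+1 * g y).

(* v belongs to h^2 of the half-space, with boundary values g. The values of v
   outside the half-space are irrelevant. *)
Definition h2_with_boundary v g : Prop :=
  [/\ g \in Lfun (lebesgue_tuple R m) 2%:E,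
      harmonic_on half_space v &
      forall x, half_space x -> v x = poisson_integral g x].

Definition L2norm g : R := fine ('N[lebesgue_tuple R m]_2%:E[EFin \o g])%E.

Definition bounding_coef (F : (point -> R) -> R) : set R :=
  [set C | forall v g, h2_with_boundary v g -> F v <= C * L2norm g].

Definition sharp_coef (F : (point -> R) -> R) (C : R) : Prop :=
  bounding_coef F C /\ lbound (bounding_coef F) C.

End half_space.

Definition alpha_cond (R : realType) (n : nat) (alpha : R) : bool :=
  (0 <= alpha <= 1 / 2) || (1 / 2 + 1 / n%:R <= alpha).

Definition sharp_const (R : realType) (n : nat) (alpha : R) : R :=
  if alpha_cond n alpha then
    Num.sqrt (n%:R / (2 ^+ (n - 2) * omega n) *
              (n%:R * alpha ^+ 2 - (n%:R + 1) * alpha + (n%:R + 3) / 4))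
  else Num.sqrt (n%:R / (2 ^+ n * omega n)).

(* Main.v *)
Require Import Defs.
From HB Require Import structures.
From mathcomp Require Import all_boot all_order all_algebra.
From mathcomp Require Import all_classical all_reals all_analysis.
From mathcomp Require Import measurable_realfun.
From mathcomp Require Import ring lra.
Import Order.TTheory GRing.Theory Num.Theory.
Import numFieldNormedType.Exports.

Set Implicit Arguments.
Unset Strict Implicit.
Unset Printing Implicit Defensive.

Local Open Scope classical_set_scope.
Local Open Scope ring_scope.

(** Put m = n - 1, b = n alpha - 1 and u = x - (y, 0).  The Poisson kernel is
    u_n / |u|^n up to the factor 2 / omega_n, and u_n = x_n for every boundary
    point y.  Differentiating x_n^b v(x) under the integral sign therefore gives

      d_i (x_n^b v) (x) = K * int E_i(y) v(y) dy,   K = 2 n x_n^b / omega_n,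
      E_i = delta_in alpha |u|^(-n) - x_n u_i |u|^(-n-2)

    ([grad_kernel], [is_derive_weighted]).  So the question is the norm of the
    linear map sending v to the vector of its L2 inner products with the E_i.
    Reflecting one boundary coordinate about that of x shows that the E_i are
    pairwise orthogonal ([grad_kernel_orthogonal]); the norm of the map is then
    the largest of the norms |E_i| (a Bessel inequality, [grad_bound]), and it
    is attained at v = E_i for a maximising i ([partial_sharp]).  All tangential
    E_i have the same norm, so only two numbers have to be compared, and
    [alpha_cond] says precisely that the normal one is at least as large
    ([alpha_cond_energy]).  In that case the extremal v already maximises the
    normal derivative alone, whence the last assertion.

    The norms are integrals of |u|^(-2k) and u_i^2 |u|^(-2k).  Writing |u|^(-2k)
    as a Gaussian mixture, a multiple of the integral over s > 0 of
    s^(2k-1) exp(- s^2 |u|^2), and exchanging the integrals factors them into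
    one-dimensional Gaussian moments ([integral_tuple_radial]).  The moments
    over the half-line satisfy a two-step recursion, give Gamma(n/2), and obey
    a duplication formula that turns the outcome into omega_n / 2^n
    ([mass_omega]).

    Attaining the bound needs the Poisson integral of a square-integrable
    function to be a harmonic function.  Every kernel that occurs is a
    combination of monomials in u divided by powers of |u|, bounded by a multiple
    of |u|^(-m) locally uniformly in x ([admissible]); as |u|^(-m) is square
    integrable, dominated convergence gives differentiability
    ([is_derive_potential]) and continuity ([continuous_potential]), and the
    Laplacian is computed on the kernel ([laplacian_poisson_kernel]). *)

(** * Affine changes of variable for Lebesgue measure *)

Section affine.
Context {R : realType}.
Notation leb := (@lebesgue_measure R).

Let affine (a c : R) (y : measurableTypeR R) : measurableTypeR R :=
  (a * (y : R) + c : R).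

Lemma measurable_affine (a c : R) :
  measurable_fun setT (affine a c).
Proof.
apply: (@measurable_funD _ _ R); last exact: measurable_cst.
exact: (@measurable_funM _ _ R).
Qed.

(** Both sides are measures in [A], so by uniqueness it is enough to compare them
    on half-open intervals. *)
Lemma lebesgue_measure_affine (a c : R) (A : set (measurableTypeR R)) :
  0 < a -> measurable A ->
  (a%:E * pushforward leb (affine a c) A =
   leb A)%E.
Proof.
move=> a0 mA.
pose f := affine a c.
pose mf := isMeasurableFun.Build _ _ _ _ f (measurable_affine a c).
pose ff : {mfun measurableTypeR R >-> measurableTypeR R} := HB.pack f mf.
have -> : (a%:E * pushforward leb f A =
  mscale (NngNum (ltW a0)) (pushforward leb ff) A)%E by [].
apply/esym/lebesgue_measure_unique => //= _ [[p q] _ <-].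
rewrite /mscale/= /pushforward.
have -> : ff @^-1` `]p, q] = `](p - c) / a, (q - c) / a]%classic.
  by apply/seteqP; split=> y /=; rewrite !in_itv/= /f ltr_pdivrMr// ler_pdivlMr//
    ltrBlDr lerBrDr (mulrC y).
rewrite !lebesgue_measure_itv/= !lte_fin ltr_pM2r ?invr_gt0// ltrD2r.
case: ifPn => pq; last by rewrite mule0.
rewrite -!EFinD -EFinM; congr EFin.
by field; rewrite gt_eqF.
Qed.

Lemma ge0_integral_affine (a c : R) (f : R -> \bar R) : 0 < a ->
  measurable_fun [set: R] f -> (forall y, (0 <= f y)%E) ->
  (\int[leb]_y f y = a%:E * \int[leb]_y f (a * y + c)%R)%E.
Proof.
move=> a0 mf f0.
pose g := affine a c.
have mg : measurable_fun setT g := measurable_affine a c.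
pose gm := isMeasurableFun.Build _ _ _ _ g mg.
pose gg : {mfun measurableTypeR R >-> measurableTypeR R} := HB.pack g gm.
have -> : (\int[leb]_y f (a * y + c)%R = \int[pushforward leb gg]_y f y)%E.
  by rewrite (ge0_integral_pushforward mg)// preimage_setT.
rewrite -(ge0_integral_mscale _ _ (NngNum (ltW a0)))//.
apply: eq_measure_integral => A mA _ /=.
by rewrite -(lebesgue_measure_affine c a0 mA).
Qed.

(** The reflection about c is the translation by 2 c after a change of sign. *)
Lemma ge0_integral_reflect (c : R) (f : R -> \bar R) :
  measurable_fun [set: R] f -> (forall y, (0 <= f y)%E) ->
  (\int[leb]_y f (2 * c - y)%R = \int[leb]_y f y)%E.
Proof.
move=> mf f0.
rewrite [RHS](ge0_integral_affine (2 * c) ltr01)// mul1e.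
pose g y := f (1 * y + 2 * c).
have mg : measurable_fun setT g.
  exact: (measurableT_comp mf (measurable_affine 1 (2 * c))).
have -> : (\int[leb]_y f (2 * c - y)%R = \int[leb]_y g (- y)%R)%E.
  by apply: eq_integral => y _; rewrite /g mul1r addrC.
pose N : measurableTypeR R -> measurableTypeR R := -%R.
have mN : measurable_fun setT N by exact: (@oppr_measurable R).
pose Nm := isMeasurableFun.Build _ _ _ _ N mN.
pose NN : {mfun measurableTypeR R >-> measurableTypeR R} := HB.pack N Nm.
have -> : (\int[leb]_y g (- y)%R = \int[pushforward leb NN]_y g y)%E.
  rewrite (ge0_integral_pushforward mN)// ?preimage_setT//.
  by move=> *; exact: f0.
by apply: eq_measure_integral => A mA _; exact: lebesgue_measureN.
Qed.

End affine.

(** * Iterated integrals over tuples *)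

Section tuple_integral.
Context {R : realType}.
Notation leb := (@lebesgue_measure R).
Notation lebt := (lebesgue_tuple R).
Notation tup k := (k.-tuple (measurableTypeR R)).

(** Tonelli's theorem for the product measure that [lebesgue_tuple] transports to
    tuples. *)
Lemma ge0_integral_tupleS k (f : tup k.+1 -> \bar R) :
  measurable_fun setT f -> (forall t, (0 <= f t)%E) ->
  (\int[lebt k.+1]_t f t =
   \int[leb]_a \int[lebt k]_t f (cons_pair (a, t)))%E.
Proof.
move=> mf f0.
have mc := @measurable_cons_pair _ (measurableTypeR R) k.
have mfc : measurable_fun setT (f \o @cons_pair _ (measurableTypeR R) k).
  exact: (measurableT_comp mf mc).
rewrite -(@fubini_tonelli1 _ _ _ _ _ leb (lebt k) _ mfc)//.
have := @ge0_integral_pushforward _ _ _ _ _ _ mc (leb \x lebt k)%E setT f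
  measurableT mf.
rewrite preimage_setT => <- //.
by move=> x; exact: f0.
Qed.

Lemma ge0_integral_tuple_prod k (f : 'I_k -> R -> R) :
  (forall i, measurable_fun setT (f i)) -> (forall i a, 0 <= f i a) ->
  (\int[lebt k]_t (\prod_(i < k) f i (tnth t i))%:E =
   \prod_(i < k) \int[leb]_a (f i a)%:E)%E.
Proof.
elim: k f => [|k IH] f mf f0.
  rewrite big_ord0; under eq_integral do rewrite big_ord0.
  by rewrite integral_cst//= /dirac indicE mem_set// mul1e.
have mp j (g : 'I_j -> R -> R) : (forall i, measurable_fun setT (g i)) ->
  measurable_fun setT (fun t : tup j => \prod_(i < j) g i (tnth t i)).
  move=> mg; apply: measurable_prod => i _.
  exact: (measurableT_comp (mg i) (measurable_tnth i)).
rewrite ge0_integral_tupleS; last 2 first.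
- by apply/measurable_EFinP; exact: mp.
- by move=> t; rewrite lee_fin prodr_ge0.
rewrite big_ord_recl -(IH (fun i => f (lift ord0 i)))//.
set P := (\int[lebt k]_t _)%E.
transitivity (\int[leb]_a ((f ord0 a)%:E * P))%E.
  apply: eq_integral => a _; rewrite -ge0_integralZl//; last 3 first.
  - apply/measurable_EFinP; apply: (mp _ (fun i => f (lift ord0 i))) => i.
    exact: mf.
  - by move=> t _; rewrite lee_fin prodr_ge0.
  - by rewrite lee_fin.
  apply: eq_integral => t _; rewrite big_ord_recl EFinM.
  by under eq_bigr do rewrite tnthS.
rewrite ge0_integralZr//.
- exact: (measurableT_comp (@EFin_measurable R setT) (mf ord0)).
- by move=> a _; rewrite lee_fin.
- by apply: integral_ge0 => t _; rewrite lee_fin prodr_ge0.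
Qed.

(** The reflection of the boundary about the hyperplane on which coordinate i
    equals c. *)
Definition flip k (i : 'I_k) (c : R) (t : tup k) : tup k :=
  [tuple if j == i then (2 * c - (tnth t j : R) : R) else tnth t j | j < k].

Lemma measurable_flip k (i : 'I_k) c : measurable_fun setT (flip i c).
Proof.
apply/measurable_fun_tnthP => j.
have -> : (@tnth k (measurableTypeR R))^~ j \o flip i c =
  fun t : tup k => if j == i then (2 * c - (tnth t j : R) : R) else tnth t j.
  by apply/funext => t /=; rewrite tnth_mktuple.
case: (j == i); last exact: measurable_tnth.
apply: (@measurable_funB _ _ R) => //; exact: measurable_tnth.
Qed.

(** Induction on k: either the first coordinate is the reflected one, and the
    one-dimensional lemma applies to the outer integral, or the reflection acts
    inside the inner integral. *)
Lemma ge0_integral_flip k (i : 'I_k) (c : R) (f : tup k -> \bar R) :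
  measurable_fun setT f -> (forall t, (0 <= f t)%E) ->
  (\int[lebt k]_t f (flip i c t) = \int[lebt k]_t f t)%E.
Proof.
elim: k i f => [[]//|k IH] i f mf f0.
have mc := @measurable_cons_pair _ (measurableTypeR R) k.
have mfc : measurable_fun setT (f \o @cons_pair _ (measurableTypeR R) k).
  exact: (measurableT_comp mf mc).
rewrite !ge0_integral_tupleS//; last exact: (measurableT_comp mf (measurable_flip i c)).
have [->|] := eqVneq i ord0; last first.
  rewrite eq_sym => /unlift_some[j -> _].
  apply: eq_integral => a _; rewrite -[RHS](IH j)//.
    apply: eq_integral => t _; congr f; apply/eq_from_tnth => l.
    rewrite tnth_mktuple; have [->|] := eqVneq l ord0.
      by [].
    rewrite eq_sym => /unlift_some[l' -> _].
    by rewrite !tnthS tnth_mktuple (inj_eq lift_inj).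
  by apply: (measurableT_comp mfc); exact: measurable_pair1.
rewrite -(@ge0_integral_reflect _ c (fun a => \int[lebt k]_t f (cons_pair (a, t)))%E).
- apply: eq_integral => a _; apply: eq_integral => t _; congr f.
  apply/eq_from_tnth => l; rewrite tnth_mktuple.
  have [->//|] := eqVneq l ord0.
  rewrite eq_sym => /unlift_some[l' -> _].
  by rewrite !tnthS.
- exact: (measurable_fun_fubini_tonelli_F (m2 := lebt k) _ mfc (fun x => f0 _)).
- by move=> a; exact: integral_ge0.
Qed.

End tuple_integral.

(** * Gaussian moments and the Gamma function at half-integers *)

Section gauss_moments.
Context {R : realType}.
Notation leb := (@lebesgue_measure R).

(** The integral over the half-line of u^j exp(- u^2), see
    [integral_poly_gauss]. *)
Fixpoint gauss_moment (j : nat) : R :=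
  match j with
  | 0 => Num.sqrt pi / 2
  | 1 => 1 / 2
  | j'.+2 => (j'.+1)%:R / 2 * gauss_moment j'
  end.

Lemma gauss_momentSS j :
  gauss_moment j.+2 = (j.+1)%:R / 2 * gauss_moment j.
Proof. by []. Qed.

Lemma gauss_moment_gt0 j : 0 < gauss_moment j.
Proof.
suff: 0 < gauss_moment j /\ 0 < gauss_moment j.+1 by case.
elim: j => [|j [IH1 IH2]] /=.
  by split; rewrite divr_gt0// sqrtr_gt0 pi_gt0.
by split=> //; rewrite mulr_gt0// divr_gt0// ltr0n.
Qed.

(** Legendre's duplication formula at the half-integers, as the moment of order j
    is Gamma((j + 1) / 2) / 2.  Both sides are multiplied by j + 1 when j grows
    by one. *)
Lemma gauss_moment_duplication j :
  gauss_moment j * gauss_moment j.+1 * 2 ^+ j.+1 =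
  Num.sqrt pi * gauss_moment j.*2.+1.
Proof.
elim: j => [|j IH]; first by rewrite /= expr1; field.
rewrite doubleS !gauss_momentSS.
transitivity ((j.+1)%:R * (gauss_moment j * gauss_moment j.+1 * 2 ^+ j.+1)).
  by rewrite [2 ^+ j.+2]exprS; field.
by rewrite IH -[j.*2.+2]doubleS -[j.+1.*2]muln2 natrM; field.
Qed.

Let tail (v : R) := 2 * v * expR (- v ^+ 2).

Let tailE (v : R) : is_derive v 1 (fun v : R => - expR (- v ^+ 2)) (tail v).
Proof.
apply: is_derive_eq; rewrite /tail /GRing.scale/=; ring.
Qed.

Let continuous_poly_gauss j : continuous (fun u : R => u ^+ j * expR (- u ^+ 2)).
Proof.
move=> u; apply: cvgM; first exact: exprn_continuous.
exact: (@continuous_gauss_fun R u).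
Qed.

Let continuous_tail : continuous tail.
Proof.
move=> u; apply: cvgM; last exact: (@continuous_gauss_fun R u).
by apply: cvgM; [exact: cvg_cst|exact: cvg_id].
Qed.

Lemma integral_gauss_tail (a : R) : 0 <= a ->
  (\int[leb]_(v in `[a, +oo[) (tail v)%:E = (expR (- a ^+ 2))%:E)%E.
Proof.
move=> a0; rewrite (@ge0_continuous_FTC2y _ tail (fun v => - expR (- v ^+ 2)) a 0).
- by rewrite -EFinB opprK add0r.
- by move=> x ax; rewrite /tail !mulr_ge0 ?expR_ge0// (le_trans a0).
- by apply: continuous_subspaceT; exact: continuous_tail.
- rewrite -oppr0; apply: cvgN; exact: cvg_gauss_fun.
- by move=> x _; have [] := tailE x.
- apply: cvgN; apply: cvg_at_right_filter; exact: (@continuous_gauss_fun R a).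
- by move=> x _; rewrite derive1E; have [] := tailE x.
Qed.

Let integral_pow j (v : R) : 0 <= v ->
  (\int[leb]_(u in `[0%R, v]) (j.+1%:R * u ^+ j)%:E = (v ^+ j.+1)%:E)%E.
Proof.
rewrite le_eqVlt => /predU1P[<-|v0].
  by rewrite set_itv1 integral_set1 expr0n.
rewrite (@continuous_FTC2 _ _ (fun u => u ^+ j.+1))//.
- by rewrite expr0n/= sube0.
- apply: continuous_subspaceT => u; apply: cvgM; first exact: cvg_cst.
  exact: exprn_continuous.
- split; first by move=> x _; exact: exprn_derivable.
  + by apply: cvg_at_right_filter; exact: exprn_continuous.
  + by apply: cvg_at_left_filter; exact: exprn_continuous.
- by move=> x _; rewrite exp_derive1 -mulr_natl.
Qed.

(** Since b(v)^(j+1) is the integral of (j+1) u^j over 0 <= u <= b(v), the left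
    side is a double integral over the region u <= b(v); the region is also
    v >= c(u), so integrating in v first gives the right side.  This replaces an
    improper integration by parts when b is the identity, and the improper
    substitution v = u^2 when b is the square root. *)
Lemma layer_cake j (g b c T : R -> R) :
  measurable_fun setT g -> (forall v, 0 <= v -> 0 <= g v) ->
  measurable_fun setT b -> (forall v, 0 <= v -> 0 <= b v) ->
  (forall u, 0 <= u -> 0 <= c u) ->
  (forall u v, 0 <= u -> 0 <= v -> (u <= b v) = (c u <= v)) ->
  (forall u, 0 <= u -> (\int[leb]_(v in `[c u, +oo[) (g v)%:E = (T u)%:E)%E) ->
  (\int[leb]_(v in `[0%R, +oo[) (b v ^+ j.+1 * g v)%:E =
   \int[leb]_(u in `[0%R, +oo[) (j.+1%:R * (u ^+ j * T u))%:E)%E.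
Proof.
move=> mg g0 mb b0 c0 bc gT.
pose h (p : R * R) : R :=
  if [&& 0 <= p.1, 0 <= p.2 & p.1 <= b p.2]
  then (j.+1%:R * p.1 ^+ j) * g p.2 else 0.
have mh : measurable_fun setT (fun p => (h p)%:E).
  apply/measurable_EFinP; apply: measurable_fun_ifT => //.
    apply: measurable_and; first by apply: measurable_fun_ler.
    apply: measurable_and; apply: measurable_fun_ler => //.
    exact: (measurableT_comp mb measurable_snd).
  apply: measurable_funM; last exact: (measurableT_comp mg measurable_snd).
  by apply: measurable_funM => //; apply: measurable_funX; exact: measurable_fst.
have h0 p : (0 <= (h p)%:E)%E.
  rewrite lee_fin /h; case: ifPn => [/and3P[p1 p2 p12]|//] /=.
  by rewrite !mulr_ge0 ?exprn_ge0 ?g0.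
have := @fubini_tonelli _ _ _ _ _ leb leb _ mh h0.
rewrite [LHS](_ : _ =
  \int[leb]_(u in `[0%R, +oo[) (j.+1%:R * (u ^+ j * T u))%:E)%E; last first.
  rewrite [RHS]integral_mkcond; apply: eq_integral => u _.
  rewrite patchE mem_setE in_itv/= andbT; case: ifPn; last first.
    move=> u0; apply: integral0_eq => v _.
    by rewrite /h/= (negbTE u0).
  move=> u0; rewrite mulrA EFinM -(gT u u0) -ge0_integralZl//.
  - rewrite [RHS]integral_mkcond; apply: eq_integral => v _.
    rewrite patchE mem_setE in_itv/= andbT /h/= u0/=.
    have [v0|v0] := leP 0 v; first by rewrite /= bc//; case: ifPn.
    by rewrite /= [c u <= v]leNgt (lt_le_trans v0 (c0 u u0)).
  - by apply/measurable_EFinP; exact: measurable_funTS.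
  - move=> v; rewrite /= in_itv/= andbT => uv.
    by rewrite lee_fin g0// (le_trans (c0 u u0)).
  - by rewrite lee_fin mulr_ge0// exprn_ge0.
move=> ->; rewrite [LHS]integral_mkcond; apply: eq_integral => v _.
rewrite patchE mem_setE in_itv/= andbT; case: ifPn; last first.
  move=> v0; apply/esym/integral0_eq => u _; rewrite /h/=.
  by rewrite (negbTE v0) andbF.
move=> v0; rewrite EFinM -integral_pow ?b0// -ge0_integralZr//.
- rewrite [LHS]integral_mkcond; apply: eq_integral => u _.
  by rewrite patchE mem_setE in_itv/= /h/= v0/=; case: ifPn.
- apply/measurable_EFinP; apply: measurable_funM => //; exact: measurable_funX.
- by move=> u; rewrite /= in_itv/= => /andP[u0 _]; rewrite lee_fin mulr_ge0// exprn_ge0.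
- by rewrite lee_fin g0.
Qed.

Let gauss_moment_step j :
  (\int[leb]_(v in `[0%R, +oo[) (v ^+ j.+1 * tail v)%:E =
   \int[leb]_(u in `[0%R, +oo[) (j.+1%:R * (u ^+ j * expR (- u ^+ 2)))%:E)%E.
Proof.
apply: (@layer_cake j tail id id) => //.
- exact: continuous_measurable_fun.
- by move=> v v0; rewrite /tail !mulr_ge0 ?expR_ge0.
- exact: integral_gauss_tail.
Qed.

Lemma measurable_poly_gauss j (D : set R) :
  measurable_fun D (fun u : R => (u ^+ j * expR (- u ^+ 2))%:E).
Proof.
apply/measurable_EFinP; apply: measurable_funTS.
exact: continuous_measurable_fun.
Qed.

(** Orders 0 and 1 are the Gaussian integral and an exact derivative; the two-step
    recursion is [layer_cake] for the tail integral of 2 v exp(- v^2). *)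
Lemma integral_poly_gauss j :
  (\int[leb]_(u in `[0%R, +oo[) (u ^+ j * expR (- u ^+ 2))%:E =
   (gauss_moment j)%:E)%E.
Proof.
pose I j := (\int[leb]_(u in `[0%R, +oo[) (u ^+ j * expR (- u ^+ 2))%:E)%E.
have ge0 i (x : R) : (`[0, +oo[%classic : set R) x ->
    (0 <= (x ^+ i * expR (- x ^+ 2))%:E)%E.
  rewrite /= in_itv/= andbT => x0.
  by rewrite lee_fin mulr_ge0 ?exprn_ge0 ?expR_ge0.
suff: I j = (gauss_moment j)%:E /\ I j.+1 = (gauss_moment j.+1)%:E by case.
elim: j => [|j [IH1 IH2]].
  split.
    by rewrite /I -integral0y_gauss; apply: eq_integral => u _; rewrite expr0 mul1r.
  have := integral_gauss_tail (lexx 0); rewrite expr0n/= oppr0 expR0 /tail.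
  under eq_integral do rewrite -mulrA EFinM.
  rewrite ge0_integralZl//; last 2 first.
  - exact: (measurable_poly_gauss 1).
  - exact: (ge0 1).
  rewrite -[(\int[_]_(_ in _) _)%E]/(I 1) => /eqP.
  by rewrite eq_sym -eqe_pdivrMl ?pnatr_eq0// => /eqP <-; rewrite /= mule1 div1r.
split=> //.
have := gauss_moment_step j.
under eq_integral => v _.
  rewrite (_ : _ * _ = 2 * (v ^+ j.+2 * expR (- v ^+ 2))); last first.
    by rewrite /tail [v ^+ j.+2]exprS; ring.
  rewrite EFinM.
  over.
rewrite ge0_integralZl//; last 2 first.
- exact: (measurable_poly_gauss j.+2).
- exact: (ge0 j.+2).
under [in RHS]eq_integral do rewrite EFinM.
rewrite ge0_integralZl//; last 2 first.
- exact: (measurable_poly_gauss j).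
- exact: (ge0 j).
rewrite -[(\int[_]_(_ in _) _)%E in LHS]/(I j.+2).
rewrite -[(\int[_]_(_ in _) _)%E in RHS]/(I j) IH1.
move=> /eqP; rewrite eq_sym -eqe_pdivrMl// => /eqP <-.
by rewrite -!EFinM gauss_momentSS; congr EFin; field.
Qed.

Let integral_exp_tail (a : R) : 0 <= a ->
  (\int[leb]_(v in `[a, +oo[) (expR (- v))%:E = (expR (- a))%:E)%E.
Proof.
move=> a0.
have ce : continuous (fun v : R => expR (- v)).
  by move=> v; apply: (@continuous_comp _ _ _ -%R expR);
    [exact: opp_continuous|exact: continuous_expR].
have de (v : R) : is_derive v 1 (fun v : R => - expR (- v)) (expR (- v)).
  by apply: is_derive_eq; rewrite /GRing.scale/=; ring.
rewrite (@ge0_continuous_FTC2y _ _ (fun v => - expR (- v)) a 0).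
- by rewrite -EFinB opprK add0r.
- by move=> x ax; exact: expR_ge0.
- by apply: continuous_subspaceT.
- rewrite -oppr0; apply: cvgN; exact: cvgr_expR.
- by move=> x _; have [] := de x.
- apply: cvgN; apply: cvg_at_right_filter; exact: ce.
- by move=> x _; rewrite derive1E; have [] := de x.
Qed.

Lemma powR_half (t : R) j : 0 <= t -> t `^ (j%:R / 2) = Num.sqrt t ^+ j.
Proof.
by move=> t0; rewrite mulrC powRrM powR12_sqrt// powR_mulrn.
Qed.

(** The substitution t = u^2 turns the Gamma integral at n/2 into twice the moment
    of order n - 1; it is carried out by [layer_cake] with b the square root,
    which produces (n - 2) times the moment of order n - 3. *)
Lemma Gamma_half j : Gamma (j.+3%:R / 2 : R) = 2 * gauss_moment j.+2.
Proof.
rewrite /Gamma /Rintegral.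
rewrite (_ : (\int[_]_(t in _) _)%E = (2 * gauss_moment j.+2)%:E)//.
have mexp : measurable_fun setT (fun t : R => expR (- t)).
  by apply: measurableT_comp.
have msqrt : measurable_fun setT (@Num.sqrt R).
  by apply: continuous_measurable_fun; exact: sqrt_continuous.
transitivity (\int[leb]_(t in `]0%R, +oo[)
   (Num.sqrt t ^+ j.+1 * expR (- t))%:E)%E.
  apply: eq_integral => t; rewrite inE/= in_itv/= andbT => t0.
  rewrite -powR_half ?ltW//; congr (_ `^ _ * _)%:E.
  by rewrite -[j.+3]addn2 natrD; field.
rewrite integral_itv_obnd_cbnd; last first.
  apply/measurable_EFinP; apply: measurable_funTS.
  by apply: measurable_funM => //; exact: measurable_funX.
rewrite (@layer_cake j (fun t => expR (- t)) Num.sqrt (fun u => u ^+ 2)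
  (fun u => expR (- u ^+ 2)))//.
- under eq_integral do rewrite EFinM.
  rewrite ge0_integralZl//; last 2 first.
  - exact: measurable_poly_gauss.
  - move=> u; rewrite /= in_itv/= andbT => u0.
    by rewrite lee_fin mulr_ge0 ?exprn_ge0 ?expR_ge0.
  rewrite integral_poly_gauss -EFinM gauss_momentSS; congr EFin.
  by field.
- by move=> u _; exact: sqr_ge0.
- move=> u v u0 v0; rewrite -[in RHS](sqr_sqrtr v0).
  by rewrite ler_pXn2r// nnegrE.
- by move=> u u0; rewrite integral_exp_tail ?sqr_ge0.
Qed.

End gauss_moments.
Arguments gauss_moment : simpl never.

(** * Integrals of powers of the distance to a point *)

(** On nonnegative reals the inverse is the power of exponent -1. *)
Lemma measurable_funV_ge0 d (T : measurableType d) (R : realType) (f : T -> R) :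
  (forall t, 0 <= f t) -> measurable_fun setT f ->
  measurable_fun setT (fun t => (f t)^-1).
Proof.
move=> f0 mf; under eq_fun do rewrite -powR_inv1//.
exact: (measurableT_comp (@measurable_powR R (-1)) mf).
Qed.

Section radial_integrals.
Context {R : realType}.
Notation leb := (@lebesgue_measure R).
Notation lebt := (lebesgue_tuple R).
Notation tup k := (k.-tuple (measurableTypeR R)).
Notation gauss_moment := (@gauss_moment R).

Lemma integral_poly_gauss_scale j (a : R) : 0 < a ->
  (\int[leb]_u (if 0 < u then u ^+ j * expR (- (a * u) ^+ 2) else 0)%:E =
   (gauss_moment j / a ^+ j.+1)%:E)%E.
Proof.
move=> a0.
pose f (y : R) := if 0 < y then y ^+ j * expR (- y ^+ 2) else 0.
have mf : measurable_fun setT (fun y => (f y)%:E).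
  apply/measurable_EFinP; apply: measurable_fun_ifT => //.
    exact: measurable_fun_ltr.
  by apply/measurable_EFinP; exact: measurable_poly_gauss.
have f0 y : (0 <= (f y)%:E)%E.
  rewrite lee_fin /f; case: ifPn => // y0.
  by rewrite mulr_ge0 ?expR_ge0// exprn_ge0// ltW.
have intf : (\int[leb]_y (f y)%:E = (gauss_moment j)%:E)%E.
  rewrite -integral_poly_gauss -integral_itv_obnd_cbnd; last first.
    exact: measurable_poly_gauss.
  rewrite [RHS]integral_mkcond; apply: eq_integral => y _.
  by rewrite patchE mem_setE in_itv/= andbT /f; case: ifPn.
rewrite EFinM -intf (ge0_integral_affine 0 a0 mf f0).
have aj : a ^+ j.+1 != 0 by rewrite expf_neq0// gt_eqF.
rewrite muleAC -EFinM -ge0_integralZl//=; last 2 first.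
- exact: (measurableT_comp mf (@measurable_affine R a 0)).
- by rewrite lee_fin divr_ge0 ?exprn_ge0 ?ltW.
apply: eq_integral => u _; rewrite -EFinM /f addr0 pmulr_rgt0//.
case: ifPn => _; last by rewrite mulr0.
congr EFin; rewrite [a ^+ j.+1]exprS [(a * u) ^+ j]exprMn.
by field; rewrite expf_neq0 ?gt_eqF.
Qed.

Lemma integral_line_poly_gauss j (a c : R) : 0 < a -> ~~ odd j ->
  (\int[leb]_y ((y - c) ^+ j * expR (- (a * (y - c)) ^+ 2))%:E =
   (2 * gauss_moment j / a ^+ j.+1)%:E)%E.
Proof.
move=> a0 evj.
pose f (y : R) := y ^+ j * expR (- y ^+ 2).
have cf : continuous f.
  move=> u; apply: cvgM; first exact: exprn_continuous.
  exact: (@continuous_gauss_fun R u).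
have mf : measurable_fun setT (fun y => (f y)%:E).
  by apply/measurable_EFinP; exact: continuous_measurable_fun.
have f0 y : 0 <= f y by rewrite mulr_ge0 ?expR_ge0// exprn_even_ge0.
have intf : (\int[leb]_y (f y)%:E = (2 * gauss_moment j)%:E)%E.
  rewrite ge0_symfun_integralT//; last first.
    by move=> x /=; rewrite /f sqrrN exprNn -signr_odd (negbTE evj) mul1r.
  rewrite EFinM -integral_poly_gauss; congr (_ * _)%E.
  rewrite (_ : [set x | _] = `[0, +oo[%classic)//.
  by apply/seteqP; split => x/=; rewrite in_itv/= andbT.
rewrite EFinM -intf (ge0_integral_affine (- (a * c)) a0 mf); last first.
  by move=> y; rewrite lee_fin.
have aj : a ^+ j.+1 != 0 by rewrite expf_neq0// gt_eqF.
rewrite muleAC -EFinM -ge0_integralZl//=; last 3 first.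
- exact: (measurableT_comp mf (@measurable_affine R a _)).
- by move=> y _; rewrite lee_fin.
- by rewrite lee_fin divr_ge0 ?exprn_ge0 ?ltW.
apply: eq_integral => u _; rewrite -EFinM /f -mulrBr.
congr EFin; rewrite [a ^+ j.+1]exprS [(a * (u - c)) ^+ j]exprMn.
by field; rewrite expf_neq0 ?gt_eqF.
Qed.

Lemma integral_tuple_poly_gauss k (e : 'I_k -> nat) (c : 'I_k -> R) (a : R) :
  0 < a -> (forall i, ~~ odd (e i)) ->
  (\int[lebt k]_t (\prod_(i < k) (tnth t i - c i) ^+ e i *
      expR (- (a ^+ 2 * \sum_(i < k) (tnth t i - c i) ^+ 2)))%:E =
   ((\prod_(i < k) (2 * gauss_moment (e i))) / a ^+ (\sum_(i < k) (e i).+1))%:E)%E.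
Proof.
move=> a0 eve.
have := @ge0_integral_tuple_prod R k
  (fun i y => (y - c i) ^+ e i * expR (- (a * (y - c i)) ^+ 2)).
under eq_integral => t _.
  rewrite (_ : \prod_(i < k) _ =
   \prod_(i < k) (tnth t i - c i) ^+ e i *
      expR (- (a ^+ 2 * \sum_(i < k) (tnth t i - c i) ^+ 2))); last first.
    rewrite big_split/=; congr (_ * _).
    rewrite mulr_sumr -sumrN expR_sum; apply: eq_bigr => i _.
    by rewrite exprMn.
  over.
move=> ->; last 2 first.
- move=> i; apply: measurable_funM.
    by apply: measurable_funX; exact: measurable_funB.
  apply: measurableT_comp => //; apply: measurableT_comp => //.
  by apply: measurable_funX; apply: measurable_funM => //; exact: measurable_funB.
- by move=> i y; rewrite mulr_ge0 ?expR_ge0// exprn_even_ge0.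
rewrite expr_sum -prodf_div -prodEFin.
by apply: eq_bigr => i _; exact: integral_line_poly_gauss.
Qed.

(** With S the sum of squares, 1 / (h^2 + S)^(p+1) times the moment of order
    2 p + 1 is the integral over u > 0 of u^(2p+1) exp(- u^2 (h^2 + S)).  After
    exchanging the integrals the inner one is a product of line integrals equal
    to a constant times u^(-N), and the outer one is again a moment. *)
Lemma integral_tuple_radial k (e : 'I_k -> nat) (c : 'I_k -> R) (h : R)
    (p : nat) :
  0 < h -> (forall i, ~~ odd (e i)) ->
  let N := (\sum_(i < k) (e i).+1)%N in (N <= p.*2.+1)%N ->
  (\int[lebt k]_t (\prod_(i < k) (tnth t i - c i) ^+ e i /
      (h ^+ 2 + \sum_(i < k) (tnth t i - c i) ^+ 2) ^+ p.+1)%:E =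
   ((\prod_(i < k) (2 * gauss_moment (e i))) * gauss_moment (p.*2.+1 - N) /
     (gauss_moment p.*2.+1 * h ^+ (p.*2.+2 - N)))%:E)%E.
Proof.
move=> h0 eve N Np.
pose s (t : tup k) : R := \sum_(i < k) ((tnth t i : R) - c i) ^+ 2.
pose w (t : tup k) : R := \prod_(i < k) ((tnth t i : R) - c i) ^+ e i.
have s0 t : 0 <= s t by apply: sumr_ge0 => i _; rewrite sqr_ge0.
have w0 t : 0 <= w t by apply: prodr_ge0 => i _; rewrite exprn_even_ge0.
have mti i : measurable_fun setT (fun t : tup k => (tnth t i : R) - c i).
  by apply: measurable_funB => //; exact: measurable_tnth.
have ms : measurable_fun setT s.
  by apply: measurable_sum => i; exact: measurable_funX.
have mw : measurable_fun setT w.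
  by apply: measurable_prod => i _; exact: measurable_funX.
(* u = 0 is left out: there the integral over the tuples would be infinite. *)
pose F (z : tup k * measurableTypeR R) : R :=
  if 0 < (z.2 : R) then w z.1 * ((z.2 : R) ^+ p.*2.+1 *
     expR (- ((z.2 : R) ^+ 2 * (h ^+ 2 + s z.1)))) else 0.
have m2 : measurable_fun setT (fun z : tup k * measurableTypeR R => z.2 : R).
  exact: measurable_snd.
have mF : measurable_fun setT (fun z => (F z)%:E).
  apply/measurable_EFinP; apply: measurable_fun_ifT => //.
    exact: measurable_fun_ltr.
  apply: measurable_funM; first exact: (measurableT_comp mw measurable_fst).
  apply: measurable_funM; first exact: measurable_funX.
  apply: measurableT_comp => //; apply: measurableT_comp => //.
  apply: measurable_funM; first exact: measurable_funX.
  by apply: measurable_funD => //; exact: (measurableT_comp ms measurable_fst).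
have F0 z : (0 <= (F z)%:E)%E.
  rewrite lee_fin /F; case: ifPn => // z0.
  by rewrite !mulr_ge0 ?expR_ge0// exprn_ge0// ltW.
have := @fubini_tonelli _ _ _ _ _ (lebt k) leb _ mF F0.
have gp := @gauss_moment_gt0 R p.*2.+1.
rewrite [LHS](_ : _ = ((gauss_moment p.*2.+1)%:E *
    \int[lebt k]_t (\prod_(i < k) (tnth t i - c i) ^+ e i /
      (h ^+ 2 + \sum_(i < k) (tnth t i - c i) ^+ 2) ^+ p.+1)%:E))%E; last first.
  rewrite -ge0_integralZl//; last 3 first.
  - apply/measurable_EFinP; apply: measurable_funM => //.
    apply: measurable_funV_ge0; last exact/measurable_funX/measurable_funD.
    by move=> t; rewrite exprn_ge0// addr_ge0 ?sqr_ge0 ?s0.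
  - by move=> t _; rewrite lee_fin divr_ge0// ?w0// exprn_ge0// addr_ge0 ?sqr_ge0 ?s0.
  - by rewrite lee_fin ltW.
  apply: eq_integral => t _.
  have r0 : 0 < h ^+ 2 + s t by rewrite ltr_wpDr// exprn_gt0.
  have sr0 : 0 < Num.sqrt (h ^+ 2 + s t) by rewrite sqrtr_gt0.
  have := @integral_poly_gauss_scale p.*2.+1 _ sr0.
  rewrite -doubleS -[p.+1.*2]mul2n exprM sqr_sqrtr ?ltW// => intu.
  rewrite -[\prod_(i < k) _]/(w t) -[\sum_(i < k) _]/(s t).
  rewrite -EFinM mulrCA EFinM -intu -ge0_integralZl//.
  - by apply: eq_integral => u _; rewrite /F/=; case: ifPn => u0;
      rewrite -EFinM ?mulr0// exprMn sqr_sqrtr ?ltW// [u ^+ 2 * _]mulrC.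
  - apply/measurable_EFinP; apply: measurable_fun_ifT => //.
      exact: measurable_fun_ltr.
    apply: measurable_funM => //; apply: measurableT_comp => //.
    apply: measurableT_comp => //; apply: measurable_funX; exact: measurable_funM.
  - move=> u _; rewrite lee_fin; case: ifPn => // u0.
    by rewrite !mulr_ge0 ?expR_ge0// exprn_ge0// ltW.
  - by rewrite lee_fin w0.
rewrite [RHS](_ : _ = ((\prod_(i < k) (2 * gauss_moment (e i))) *
     gauss_moment (p.*2.+1 - N) /
     (h ^+ (p.*2.+2 - N)))%:E)%E; last first.
  have P0 : 0 <= \prod_(i < k) (2 * gauss_moment (e i)).
    by apply: prodr_ge0 => i _; rewrite mulr_ge0// ltW// gauss_moment_gt0.
  have := @integral_poly_gauss_scale (p.*2.+1 - N) _ h0.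
  rewrite -subSn// => intu.
  rewrite -mulrA EFinM -intu -ge0_integralZl//; last 2 first.
  - apply/measurable_EFinP; apply: measurable_fun_ifT => //.
      exact: measurable_fun_ltr.
    apply: measurable_funM => //; apply: measurableT_comp => //.
    apply: measurableT_comp => //; apply: measurable_funX; exact: measurable_funM.
  - move=> u _; rewrite lee_fin; case: ifPn => // u0.
    by rewrite !mulr_ge0 ?expR_ge0// exprn_ge0// ltW.
  apply: eq_integral => u _; rewrite /F/=; case: ifPn => u0; last first.
    by rewrite mule0; apply: integral0_eq.
  transitivity (\int[lebt k]_t ((u ^+ p.*2.+1 * expR (- (h * u) ^+ 2))%:E *
     (w t * expR (- (u ^+ 2 * s t)))%:E))%E.
    apply: eq_integral => t _; rewrite -EFinM; congr EFin.
    by rewrite mulrDr opprD expRD exprMn [h ^+ 2 * _]mulrC; ring.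
  rewrite ge0_integralZl//; last 3 first.
  - apply/measurable_EFinP; apply: measurable_funM => //.
    apply: measurableT_comp => //; apply: measurableT_comp => //.
    exact: measurable_funM.
  - by move=> t _; rewrite lee_fin mulr_ge0 ?expR_ge0.
  - by rewrite lee_fin mulr_ge0 ?expR_ge0// exprn_ge0// ltW.
  rewrite integral_tuple_poly_gauss// -!EFinM; congr EFin.
  rewrite -/N -[in u ^+ p.*2.+1](subnK Np) exprD.
  by field; rewrite expf_neq0// gt_eqF.
move=> /eqP; rewrite eq_sym -eqe_pdivrMl; last by rewrite gt_eqF.
move=> /eqP <-; rewrite -EFinM; congr EFin.
by field; rewrite expf_neq0 ?gt_eqF.
Qed.

End radial_integrals.

(** * Directional derivatives of the Euclidean norm *)

Section directional_derivatives.
Context {R : realType} {V : normedModType R}.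
Implicit Types (f : V -> R) (x v : V).

(** The difference quotients of the two functions are the same function of the
    increment. *)
Lemma is_derive_alongline f x v (t df : R) :
  is_derive (t *: v + x) v f df ->
  is_derive t 1 (fun h : R => f (h *: v + x)) df.
Proof.
move=> [dfl dfE].
have E : (fun h : R =>
      h^-1 *: (((fun h : R => f (h *: v + x)) \o shift t) (h *: 1) -
               f (t *: v + x))) =
  (fun h => h^-1 *: ((f \o shift (t *: v + x)) (h *: v) - f (t *: v + x))).
  by apply/funext => h /=; rewrite scalerDl [h *: (1:R)]mulr1 addrA.
by split; rewrite /derivable /derive E.
Qed.

Lemma is_derive_fromline f x v (df : R) :
  is_derive (0 : R) 1 (fun h : R => f (h *: v + x)) df -> is_derive x v f df.
Proof.
move=> [dfl dfE].
have E : (fun h : R =>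
      h^-1 *: (((fun h : R => f (h *: v + x)) \o shift 0) (h *: 1) -
               f (0 *: v + x))) =
  (fun h => h^-1 *: ((f \o shift x) (h *: v) - f x)).
  by apply/funext => h /=; rewrite addr0 [h *: (1:R)]mulr1 scale0r add0r.
split; first by rewrite /derivable -E.
by rewrite -dfE /derive E.
Qed.

Lemma is_derive_comp1 (g : R -> R) f x v (dg df : R) :
  is_derive (f x) 1 g dg -> is_derive x v f df ->
  is_derive x v (fun z => g (f z)) (dg * df).
Proof.
move=> dgx dfx; apply: is_derive_fromline.
apply: (@is_derive1_comp _ g (fun h : R => f (h *: v + x))).
  by rewrite scale0r add0r.
by apply: is_derive_alongline; rewrite scale0r add0r.
Qed.

End directional_derivatives.

Section kernels.
Context {R : realType} {m : nat}.
Notation point := 'rV[R]_m.+1.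
Notation bdry := (m.-tuple (measurableTypeR R)).
Notation e_ i := (delta_mx 0 i : point).
Notation lebt := (lebesgue_tuple R m).
Implicit Types (u x z : point) (i j l : 'I_m.+1) (s : seq 'I_m.+1) (y : bdry).

Lemma enormN u : enorm (- u) = enorm u.
Proof. by congr Num.sqrt; apply: eq_bigr => i _; rewrite mxE sqrrN. Qed.

Lemma enorm_ge0 u : 0 <= enorm u. Proof. exact: sqrtr_ge0. Qed.

Lemma sqr_enorm u : enorm u ^+ 2 = \sum_i u 0 i ^+ 2.
Proof. by rewrite sqr_sqrtr// sumr_ge0// => i _; rewrite sqr_ge0. Qed.

Lemma coord_le_enorm u i : `|u 0 i| <= enorm u.
Proof.
rewrite -(@ler_pXn2r _ 2)// ?nnegrE ?enorm_ge0// sqr_enorm real_normK ?num_real//.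
by rewrite (bigD1 i)//= lerDl sumr_ge0// => j _; rewrite sqr_ge0.
Qed.

Lemma half_space_enorm_gt0 u : half_space u -> 0 < enorm u.
Proof.
move=> u0; apply: (lt_le_trans (u0 : 0 < _)).
by apply: le_trans (coord_le_enorm u ord_max); rewrite ler_norm.
Qed.

Lemma is_derive_coord u i j :
  is_derive u (e_ i) (fun z : point => z 0 j : R) (i == j)%:R.
Proof.
apply: is_derive_fromline.
have -> : (fun h : R => (h *: e_ i + u) 0 j) =
  (fun h : R => h * (i == j)%:R + u 0 j).
  by apply/funext => h; rewrite !mxE eqxx eq_sym.
apply: is_derive_eq; rewrite addr0 /GRing.scale/=; ring.
Qed.

Lemma is_derive_enorm u i : half_space u ->
  is_derive u (e_ i) (enorm : point -> R) (u 0 i / enorm u).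
Proof.
move=> hu; have u0 := half_space_enorm_gt0 hu.
have q0 : 0 < \sum_i u 0 i ^+ 2 by rewrite -sqr_enorm exprn_gt0.
have dq : is_derive u (e_ i) (fun z : point => \sum_j z 0 j ^+ 2 : R) (2 * u 0 i).
  have -> : (fun z : point => \sum_j z 0 j ^+ 2 : R) =
    \sum_j (fun z : point => z 0 j : R) ^+ 2.
    by apply/funext => z; rewrite fct_sumE; apply: eq_bigr => j _.
  have dc j := @is_deriveX _ _ _ 2 u (e_ i) _ (is_derive_coord u i j).
  apply: is_derive_eq (is_derive_sum dc) _.
  rewrite (bigD1 i)//= big1 => [|j ji].
    by rewrite eqxx addr0 [_ *: _]mulr1 expr1.
  by rewrite eq_sym (negbTE ji) scaler0.
apply: (is_derive_eq (is_derive_comp1 (is_derive1_sqrt q0) dq)).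
by rewrite -[Num.sqrt _]/(enorm u); field; rewrite gt_eqF.
Qed.

(** The building block of all kernels: a monomial, given by the list of its
    factors, over a power of the Euclidean norm. *)
Definition mon s p u : R := (\prod_(j <- s) u 0 j) / enorm u ^+ p.

Lemma is_derive_enormVX u i p : half_space u ->
  is_derive u (e_ i) (fun z : point => (enorm z ^+ p)^-1)
   (- p%:R * (u 0 i / enorm u ^+ p.+2)).
Proof.
move=> hu; have u0 := half_space_enorm_gt0 hu.
have dp : is_derive (enorm u) 1 (fun r : R => (r ^+ p)^-1) (- p%:R / enorm u ^+ p.+1).
  have up : enorm u ^+ p != 0 by rewrite expf_neq0// gt_eqF.
  have dX : is_derive (enorm u) 1 (fun r : R => r ^+ p) (p%:R * enorm u ^+ p.-1).
    have -> : (fun r : R => r ^+ p) = id ^+ p by apply/funext => r; rewrite exprfctE.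
    by apply: is_derive_eq; rewrite [_ *: _]mulr1.
  apply: is_derive_eq (@is_deriveV _ (fun r : R => r ^+ p) _ _ _ up dX) _.
  case: p {dX} up => [|p] up; first by rewrite /= !mul0r oppr0 scaler0 mul0r.
  rewrite /GRing.scale/= !exprS; field.
  by rewrite ?expf_neq0 ?gt_eqF.
apply: is_derive_eq (is_derive_comp1 dp (is_derive_enorm i hu)) _.
by rewrite !exprS; field; rewrite ?expf_neq0 ?gt_eqF.
Qed.

End kernels.

(** * Admissible kernels and the derivatives of the Poisson kernel *)

Section admissible.
Context {R : realType} {m : nat}.
Notation point := 'rV[R]_m.+1.
Notation bdry := (m.-tuple (measurableTypeR R)).
Notation e_ i := (delta_mx 0 i : point).
Notation lebt := (lebesgue_tuple R m).
Implicit Types (u x z : point) (i j l : 'I_m.+1) (s : seq 'I_m.+1) (y : bdry).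
Implicit Types (phi psi : point -> R).

Lemma bdry_point_last y : bdry_point y 0 ord_max = 0 :> R.
Proof. by rewrite mxE nth_default// size_tuple. Qed.

Lemma bdry_point_widen y (i : 'I_m) :
  bdry_point y 0 (widen_ord (leqnSn m) i) = tnth y i.
Proof. by rewrite mxE /= -tnth_nth. Qed.

Lemma coord_last_sub x y : (x - bdry_point y) 0 ord_max = x 0 ord_max.
Proof. by rewrite 2!mxE bdry_point_last subr0. Qed.

Lemma lift_max_widen (j : 'I_m) : lift ord_max j = widen_ord (leqnSn m) j.
Proof. by apply/val_inj; exact: lift_max. Qed.

Lemma half_space_sub x y : half_space x -> half_space (x - bdry_point y).
Proof. by rewrite /half_space/= !mxE nth_default ?size_tuple// subr0. Qed.

Lemma measurable_bdry_coord x i :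
  measurable_fun setT (fun y : bdry => (x - bdry_point y) 0 i).
Proof.
case: (unliftP ord_max i) => [j ->|->].
  have -> : (fun y : bdry => (x - bdry_point y) 0 (lift ord_max j)) =
            (fun y : bdry => x 0 (lift ord_max j) - (tnth y j : R)).
    apply/funext => y; rewrite !mxE; congr (_ - _).
    by rewrite (tnth_nth 0) /= /bump leqNgt ltn_ord.
  by apply: measurable_funB => //; exact: measurable_tnth.
have -> : (fun y : bdry => (x - bdry_point y) 0 ord_max) =
  (fun y : bdry => x 0 ord_max).
  by apply/funext => y; rewrite !mxE nth_default ?size_tuple// subr0.
exact: measurable_cst.
Qed.

Lemma measurable_bdry_enorm x :
  measurable_fun setT (fun y : bdry => enorm (x - bdry_point y)).
Proof.
have msqrt : measurable_fun setT (@Num.sqrt R).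
  by apply: continuous_measurable_fun; exact: sqrt_continuous.
have msum : measurable_fun setT
    (fun y : bdry => \sum_i (x - bdry_point y) 0 i ^+ 2).
  by apply: measurable_sum => i; apply: measurable_funX; exact: measurable_bdry_coord.
exact: (measurableT_comp msqrt msum).
Qed.

(** What is needed to integrate [phi (x - y)] against a square-integrable
    function and to pass to the limit in x: the bound makes [phi (x - y)] square
    integrable in y, locally uniformly in x. *)
Record admissible phi : Prop := Admissible {
  adm_continuous : forall u, half_space u -> {for u, continuous phi} ;
  adm_measurable : forall x,
    measurable_fun setT (fun y : bdry => phi (x - bdry_point y)) ;
  adm_bounded : forall eps : R, 0 < eps -> exists2 C : R, 0 <= C &
    forall u, eps <= u 0 ord_max -> `|phi u| * enorm u ^+ m <= C }.

Lemma admissibleD phi psi : admissible phi -> admissible psi ->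
  admissible (fun u => phi u + psi u).
Proof.
move=> [c1 m1 b1] [c2 m2 b2]; split.
- by move=> u hu; apply: continuousD; [exact: c1|exact: c2].
- by move=> x; exact: measurable_funD.
- move=> e e0; have [C1 C10 h1] := b1 _ e0; have [C2 C20 h2] := b2 _ e0.
  exists (C1 + C2); first exact: addr_ge0.
  move=> u hu; apply: le_trans (lerD (h1 _ hu) (h2 _ hu)).
  by rewrite -mulrDl ler_wpM2r ?ler_normD// exprn_ge0// enorm_ge0.
Qed.

Lemma admissibleZ (c : R) phi : admissible phi -> admissible (fun u => c * phi u).
Proof.
move=> [c1 m1 b1]; split.
- by move=> u hu; apply: continuousM; [exact: cst_continuous|exact: c1].
- by move=> x; exact: measurable_funM.
- move=> e e0; have [C1 C10 h1] := b1 _ e0.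
  exists (`|c| * C1); first exact: mulr_ge0.
  by move=> u hu; rewrite normrM -mulrA ler_wpM2l// h1.
Qed.

Lemma continuous_coord u i : {for u, continuous (fun z : point => z 0 i : R)}.
Proof. exact: coord_continuous. Qed.

Lemma continuous_enorm u : {for u, continuous (enorm : point -> R)}.
Proof.
apply: (@continuous_comp _ _ _ (fun z : point => \sum_i z 0 i ^+ 2 : R) Num.sqrt);
  last exact: sqrt_continuous.
have -> : (fun z : point => \sum_i z 0 i ^+ 2 : R) =
    \sum_i (fun z : point => z 0 i ^+ 2 : R).
  by apply/funext => z; rewrite fct_sumE.
elim/big_ind : _ => [|f g cf cg|i _]; first exact: cst_continuous.
  exact: continuousD.
exact: (@continuous_comp _ _ _ (fun z : point => z 0 i : R) (fun r => r ^+ 2) _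
  (@continuous_coord u i) (@exprn_continuous _ 2 _)).
Qed.

(** The product of the factors is at most the power [size s] of the norm, and
    surplus negative powers of the norm are bounded where u_n >= eps. *)
Lemma admissible_mon s p : (size s + m <= p)%N -> admissible (mon s p).
Proof.
move=> sp; split.
- move=> u hu; have u0 := half_space_enorm_gt0 hu.
  apply: continuousM.
    elim: s {sp} => [|j s IH].
      have -> : (fun z : point => \prod_(j <- [::]) z 0 j : R) = cst 1.
        by apply/funext => z; rewrite big_nil.
      exact: cst_continuous.
    have -> : (fun z : point => \prod_(l <- j :: s) z 0 l : R) =
      fun z => z 0 j * \prod_(l <- s) z 0 l.
      by apply/funext => z; rewrite big_cons.
    by apply: continuousM => //; exact: continuous_coord.
  apply: continuousV; first by rewrite expf_neq0// gt_eqF.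
  exact: (@continuous_comp _ _ _ (enorm : point -> R) (fun r => r ^+ p) _
    (@continuous_enorm u) (@exprn_continuous _ p _)).
- move=> x; apply: measurable_funM.
    by apply: measurable_prod => j _; exact: measurable_bdry_coord.
  apply: measurable_funV_ge0; first by move=> y; rewrite exprn_ge0// enorm_ge0.
  by apply: measurable_funX; exact: measurable_bdry_enorm.
- move=> e e0; exists (e ^+ (p - (size s + m)))^-1.
    by rewrite invr_ge0 exprn_ge0// ltW.
  move=> u eu.
  have er : e <= enorm u.
    apply: le_trans eu _; apply: le_trans (coord_le_enorm u ord_max).
    exact: ler_norm.
  have r0 : 0 < enorm u by exact: lt_le_trans er.
  have ps : `|\prod_(j <- s) u 0 j| <= enorm u ^+ size s.
    elim: s {sp} => [|j s IH]; first by rewrite big_nil normr1.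
    by rewrite big_cons normrM exprS ler_pM// coord_le_enorm.
  rewrite normrM normfV (ger0_norm (exprn_ge0 _ (ltW r0))).
  have -> : enorm u ^+ p =
      enorm u ^+ (p - (size s + m)) * (enorm u ^+ size s * enorm u ^+ m).
    by rewrite -!exprD subnK.
  set P := `|_| in ps *; set A := _ ^+ (p - _); set B := _ ^+ size s.
  have A0 : 0 < A by rewrite exprn_gt0.
  have B0 : 0 < B by rewrite exprn_gt0.
  have M0 : 0 < enorm u ^+ m by rewrite exprn_gt0.
  rewrite (_ : _ * _ = P / B * A^-1); last by field; rewrite !gt_eqF.
  apply: (@le_trans _ _ A^-1); last first.
    by rewrite lef_pV2 ?posrE ?exprn_gt0// lerXn2r// nnegrE ltW.
  apply: ler_piMl; first by rewrite invr_ge0 ltW.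
  by rewrite ler_pdivrMr// mul1r.
Qed.

(** A neighbourhood of a point of the half-space, in the sup norm, that stays in
    the half-space and on which kernels are uniformly comparable. *)
Definition near_pt x0 x : Prop := forall i, `|x0 0 i - x 0 i| <= x0 0 ord_max / 2.

Lemma near_pt_half x0 x : half_space x0 -> near_pt x0 x ->
  x0 0 ord_max / 2 <= x 0 ord_max.
Proof.
move=> hx0 nx; have := nx ord_max; rewrite ler_norml => /andP[_]; lra.
Qed.

Lemma near_ptW x0 x : half_space x0 -> near_pt x0 x -> half_space x.
Proof.
move=> hx0 nx; apply: lt_le_trans (near_pt_half hx0 nx).
by rewrite divr_gt0.
Qed.

(** Each coordinate of x0 - y differs from that of x - y by at most half the height
    of x0, which is at most the height of x, hence at most |x - y|. *)
Lemma enorm_near x0 x y : half_space x0 -> near_pt x0 x ->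
  enorm (x0 - bdry_point y) <= 2 * m.+1%:R * enorm (x - bdry_point y).
Proof.
move=> hx0 nx.
have h0 := enorm_ge0 (x - bdry_point y).
rewrite -(@ler_pXn2r _ 2)// ?nnegrE ?mulr_ge0 ?enorm_ge0// exprMn sqr_enorm.
have xr : x0 0 ord_max / 2 <= enorm (x - bdry_point y).
  apply: le_trans (near_pt_half hx0 nx) _.
  have := coord_le_enorm (x - bdry_point y) ord_max.
  by rewrite coord_last_sub; apply: le_trans; rewrite ler_norm.
apply: (@le_trans _ _ (\sum_(i < m.+1) (2 * enorm (x - bdry_point y)) ^+ 2)).
  apply: ler_sum => i _.
  rewrite -real_normK ?num_real// ler_pXn2r ?nnegrE ?mulr_ge0//.
  have -> : (x0 - bdry_point y) 0 i = (x - bdry_point y) 0 i + (x0 0 i - x 0 i).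
    by rewrite !mxE; ring.
  apply: le_trans (ler_normD _ _) _; rewrite mulr2n mulrDl mul1r lerD ?coord_le_enorm//.
  by apply: le_trans xr; exact: nx.
rewrite sumr_const card_ord -[leLHS]mulr_natl.
set r := enorm _ in h0 *; set M := m.+1%:R.
have M1 : 1 <= M by rewrite ler1n.
rewrite -subr_ge0 (_ : _ - _ = 4 * r ^+ 2 * M * (M - 1)); last by ring.
by rewrite !mulr_ge0 ?sqr_ge0 ?subr_ge0// (le_trans ler01).
Qed.

Definition decay x0 y : R := (enorm (x0 - bdry_point y) ^+ m)^-1.

Lemma decay_ge0 x0 y : 0 <= decay x0 y.
Proof. by rewrite invr_ge0 exprn_ge0// enorm_ge0. Qed.

(** A single square-integrable function of y dominates the kernel for all x near
    x0. *)
Lemma admissible_dom phi x0 : admissible phi -> half_space x0 ->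
  exists2 C : R, 0 <= C & forall x y, near_pt x0 x ->
    `|phi (x - bdry_point y)| <= C * decay x0 y.
Proof.
move=> [_ _ b] hx0.
have [|C C0 hC] := b (x0 0 ord_max / 2); first by rewrite divr_gt0.
exists (C * (2 * m.+1%:R) ^+ m) => [|x y nx].
  by rewrite mulr_ge0// exprn_ge0.
have r0 : 0 < enorm (x - bdry_point y).
  exact/half_space_enorm_gt0/half_space_sub/(near_ptW hx0).
have r1 : 0 < enorm (x0 - bdry_point y).
  exact/half_space_enorm_gt0/half_space_sub.
rewrite /decay ler_pdivlMr ?exprn_gt0//.
apply: (@le_trans _ _ (`|phi (x - bdry_point y)| *
   (2 * m.+1%:R * enorm (x - bdry_point y)) ^+ m)).
  rewrite ler_wpM2l// lerXn2r ?nnegrE ?mulr_ge0 ?enorm_ge0//.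
  exact: enorm_near.
rewrite exprMn mulrCA mulrC ler_wpM2r ?exprn_ge0// hC//.
rewrite coord_last_sub.
exact: near_pt_half.
Qed.

End admissible.

Section kernel_derivatives.
Context {R : realType} {m : nat}.
Notation point := 'rV[R]_m.+1.
Notation e_ i := (delta_mx 0 i : point).
Implicit Types (u x z : point) (i j l : 'I_m.+1).

Definition poisson_kernel u : R := mon [:: ord_max] m.+1 u.

Definition dpoisson_kernel i u : R :=
  (i == ord_max)%:R * mon [::] m.+1 u - m.+1%:R * mon [:: ord_max; i] m.+3 u.

Definition ddpoisson_kernel j i u : R :=
  - m.+1%:R * ((i == ord_max)%:R * mon [:: j] m.+3 u +
     (j == ord_max)%:R * mon [:: i] m.+3 u +
     (j == i)%:R * mon [:: ord_max] m.+3 u) +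
  m.+1%:R * m.+3%:R * mon [:: ord_max; i; j] m.+1.+4 u.

Lemma admissible_poisson_kernel : admissible poisson_kernel.
Proof. exact: admissible_mon. Qed.

Lemma admissible_dpoisson_kernel i : admissible (dpoisson_kernel i).
Proof.
have -> : dpoisson_kernel i = fun u => (i == ord_max)%:R * mon [::] m.+1 u +
   (- m.+1%:R) * mon [:: ord_max; i] m.+3 u.
  by apply/funext => u; rewrite /dpoisson_kernel mulNr.
by apply: admissibleD; apply: admissibleZ; exact: admissible_mon.
Qed.

Lemma admissible_ddpoisson_kernel j i : admissible (ddpoisson_kernel j i).
Proof.
apply: admissibleD; apply: admissibleZ; last first.
  by apply: admissible_mon; rewrite !addSn add0n !ltnS !leqW.
do 2?[apply: admissibleD]; apply: admissibleZ; apply: admissible_mon => //=.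
all: by rewrite add1n ltnS !leqW.
Qed.

Lemma is_derive_mon0 u i p : half_space u ->
  is_derive u (e_ i) (mon [::] p) (- p%:R * mon [:: i] p.+2 u).
Proof.
move=> hu; have := is_derive_enormVX i p hu.
by rewrite /mon big_seq1 (_ : (fun _ => _) = mon [::] p)//;
  apply/funext => z; rewrite /mon big_nil mul1r.
Qed.

Lemma is_derive_mon_cons u i j s p (d : R) : half_space u ->
  is_derive u (e_ i) (mon s p) d ->
  is_derive u (e_ i) (mon (j :: s) p) ((i == j)%:R * mon s p u + u 0 j * d).
Proof.
move=> hu ds.
have -> : mon (j :: s) p = (fun z : point => z 0 j : R) * mon s p.
  by apply/funext => z; rewrite /mon big_cons mulrA.
apply: is_derive_eq (is_deriveM (is_derive_coord u i j) ds) _.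
by rewrite addrC mulrC.
Qed.

Lemma is_derive_poisson_kernel u i : half_space u ->
  is_derive u (e_ i) poisson_kernel (dpoisson_kernel i u).
Proof.
move=> hu; apply: is_derive_eq (is_derive_mon_cons _ hu (is_derive_mon0 i m.+1 hu)) _.
by rewrite /dpoisson_kernel /mon !(big_cons, big_nil); ring.
Qed.

Lemma is_derive_dpoisson_kernel u j i : half_space u ->
  is_derive u (e_ j) (dpoisson_kernel i) (ddpoisson_kernel j i u).
Proof.
move=> hu.
have d1 := is_derive_mon0 j m.+1 hu.
have d2 := is_derive_mon_cons ord_max hu (is_derive_mon_cons i hu (is_derive_mon0 j m.+3 hu)).
have := is_deriveB (is_deriveZ ((i == ord_max)%:R : R) d1) (is_deriveZ (m.+1%:R : R) d2).
rewrite (_ : _ - _ = dpoisson_kernel i); last by apply/funext => z.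
move/is_derive_eq; apply.
by rewrite /ddpoisson_kernel /mon !(big_cons, big_nil) /GRing.scale/=; ring.
Qed.

(** The diagonal second derivatives add up to multiples of u_n / |u|^(n+2) with
    total coefficient - 2 n - n^2 + n (n + 2) = 0. *)
Lemma laplacian_poisson_kernel u : half_space u ->
  \sum_i ddpoisson_kernel i i u = 0.
Proof.
move=> hu; have u0 := half_space_enorm_gt0 hu.
transitivity (\sum_i (- m.+1%:R * (2 * ((i == ord_max)%:R * (u 0 i / enorm u ^+ m.+3)) +
   u 0 ord_max / enorm u ^+ m.+3) +
   m.+1%:R * m.+3%:R * u 0 ord_max / enorm u ^+ m.+1.+4 * u 0 i ^+ 2)).
  apply: eq_bigr => i _; rewrite /ddpoisson_kernel /mon !(big_cons, big_nil) eqxx mulr1n.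
  by ring.
rewrite big_split/= -!mulr_sumr big_split/= -sqr_enorm sumr_const card_ord.
rewrite -mulr_sumr (bigD1 ord_max)//= big1 => [|i /negbTE ->]; last by rewrite mul0r.
rewrite eqxx mulr1n -mulr_natl !exprS -addn2 natrD.
by field; rewrite ?expf_neq0 ?gt_eqF.
Qed.

End kernel_derivatives.

(** * Square-integrable functions and differentiation under the integral *)

Section square_integrable.
Context d (T : measurableType d) {R : realType} (mu : {measure set T -> \bar R}).
Notation L2 := (Lfun mu 2%:E).
Implicit Types (f g : T -> R).

Lemma L2_measurable g : g \in L2 -> measurable_fun setT g.
Proof. by rewrite inE => /andP[+ _]; rewrite inE. Qed.

Lemma LnormE g : ('N[mu]_2%:E[EFin \o g] `^ 2 = \int[mu]_y (g y ^+ 2)%:E)%E.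
Proof.
rewrite poweR_Lnorm//; apply: eq_integral => y _ /=.
by rewrite powR_mulrn// real_normK ?num_real.
Qed.

Lemma L2_intro g : measurable_fun setT g -> (\int[mu]_y (g y ^+ 2)%:E < +oo)%E ->
  g \in L2.
Proof.
move=> mg fin; rewrite inE; apply/andP; split; rewrite inE//=.
rewrite /finite_norm; apply: (@lty_poweRy _ _ 2) => //.
by rewrite LnormE.
Qed.

Lemma L2_integrable f g : f \in L2 -> g \in L2 ->
  mu.-integrable setT (EFin \o (fun y => f y * g y)).
Proof. by move=> fL gL; apply/Lfun1_integrable; exact: Lfun2_mul_Lfun1. Qed.

Lemma L2_dominated (C : R) f g : measurable_fun setT f ->
  (forall y, `|f y| <= C * g y) -> g \in L2 -> f \in L2.
Proof.
move=> mf fg gL; apply: L2_intro => //.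
apply: (@le_lt_trans _ _ (\int[mu]_y (C ^+ 2 * (g y ^+ 2))%:E)%E).
  apply: ge0_le_integral => //.
  - by move=> y _; rewrite lee_fin sqr_ge0.
  - by apply/measurable_EFinP; exact: measurable_funX.
  - apply/measurable_EFinP; apply: measurable_funM => //.
    by apply: measurable_funX; exact: L2_measurable.
  - move=> y _; rewrite lee_fin -exprMn -real_normK ?num_real//.
    by rewrite lerXn2r ?nnegrE// (le_trans _ (fg y)).
under eq_integral do rewrite EFinM.
rewrite ge0_integralZl//.
- rewrite lte_mul_pinfty// ?lee_fin ?sqr_ge0//.
  have := Lfun2_integrable_sqr gL => /integrableP[_].
  by under eq_integral do rewrite /= ger0_norm ?sqr_ge0//.
- by apply/measurable_EFinP/measurable_funX; exact: L2_measurable.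
- by move=> y _; rewrite lee_fin sqr_ge0.
- by rewrite lee_fin sqr_ge0.
Qed.

End square_integrable.

Section L2norm.
Context {R : realType} {m : nat}.
Notation bdry := (m.-tuple (measurableTypeR R)).
Notation lebt := (lebesgue_tuple R m).
Notation L2 := (Lfun lebt 2%:E).
Implicit Types (f g : bdry -> R).

Lemma L2norm_ge0 g : 0 <= L2norm g.
Proof. by rewrite /L2norm fine_ge0// Lnorm_ge0. Qed.

Lemma L2norm_fin g : g \in L2 -> (('N[lebt]_2%:E[EFin \o g]) = (L2norm g)%:E)%E.
Proof.
move=> /[!inE] /andP[_ /[!inE]/= fg]; rewrite /L2norm fineK//.
by rewrite ge0_fin_numE ?Lnorm_ge0.
Qed.

Lemma L2norm_sqr g : g \in L2 -> L2norm g ^+ 2 = \int[lebt]_y (g y ^+ 2).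
Proof.
move=> gL; rewrite /Rintegral -LnormE (L2norm_fin gL) poweR_EFin /=.
by rewrite powR_mulrn// L2norm_ge0.
Qed.

Lemma L2_cauchy_schwarz f g : f \in L2 -> g \in L2 ->
  `|\int[lebt]_y (f y * g y)| <= L2norm f * L2norm g.
Proof.
move=> fL gL; apply: le_trans.
  by apply: le_normr_Rintegral => //; exact: L2_integrable.
rewrite -lee_fin EFinM -!L2norm_fin//.
have h := @hoelder _ _ _ lebt f g 2 2 (L2_measurable fL) (L2_measurable gL).
apply: le_trans (h _ _ _); [|by []|by []|by lra].
rewrite Lnorm1 /Rintegral fineK//.
apply: integrable_fin_num => //.
by apply: integrable_norm; exact: L2_integrable.
Qed.

End L2norm.

Section potentials.
Context {R : realType} {m : nat}.
Hypothesis m0 : (0 < m)%N.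
Notation point := 'rV[R]_m.+1.
Notation bdry := (m.-tuple (measurableTypeR R)).
Notation e_ i := (delta_mx 0 i : point).
Notation lebt := (lebesgue_tuple R m).
Notation L2 := (Lfun lebt 2%:E).
Implicit Types (u x z : point) (i j l : 'I_m.+1) (y : bdry).
Implicit Types (phi psi : point -> R) (g : bdry -> R).

Lemma sqr_enorm_bdry x y : enorm (x - bdry_point y) ^+ 2 =
  x 0 ord_max ^+ 2 + \sum_(i < m) (tnth y i - x 0 (widen_ord (leqnSn m) i)) ^+ 2.
Proof.
rewrite sqr_enorm big_ord_recr/= coord_last_sub addrC; congr (_ + _).
by apply: eq_bigr => i _; rewrite 2!mxE bdry_point_widen -sqrrN opprB.
Qed.

(** The square of the decay function is 1 / |x - y|^(2m), whose integral over the
    m-dimensional boundary is finite. *)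
Lemma decay_L2 x : half_space x -> decay x \in L2.
Proof.
move=> hx; apply: L2_intro.
  apply: measurable_funV_ge0; first by move=> y; rewrite exprn_ge0// enorm_ge0.
  by apply: measurable_funX; exact: measurable_bdry_enorm.
have := @integral_tuple_radial R m (fun=> 0%N)
  (fun i : 'I_m => x 0 (widen_ord (leqnSn m) i)) _ m.-1 hx (fun=> isT).
rewrite /= sum1_card card_ord => /(_ _).
under eq_integral => y _.
  rewrite big1 ?mul1r; last by move=> i _; rewrite expr0.
  rewrite prednK// -sqr_enorm_bdry -exprM mulnC exprM -exprVn -/(decay x y).
  over.
move=> -> //; first exact: ltry.
by rewrite -addnn -[X in (X <= _)%N](prednK m0) ltnS leq_addr.
Qed.

Lemma admissible_L2 phi x : admissible phi -> half_space x ->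
  (fun y => phi (x - bdry_point y)) \in L2.
Proof.
move=> aphi hx; have [C C0 hC] := admissible_dom aphi hx.
apply: (L2_dominated (C := C) _ _ (decay_L2 hx)); first exact: adm_measurable.
by move=> y; apply: hC => i; rewrite subrr normr0 divr_ge0// ltW.
Qed.

Definition potential phi g x : R := \int[lebt]_y (phi (x - bdry_point y) * g y).

(** Differentiation under the integral sign along the line through x in direction
    i; [psi] is dominated on a neighbourhood of x by [admissible_dom], and the
    product of the dominating function with g is integrable. *)
Lemma is_derive_potential g phi psi i x : g \in L2 ->
  admissible phi -> admissible psi ->
  (forall u, half_space u -> is_derive u (e_ i) phi (psi u)) ->
  half_space x -> is_derive x (e_ i) (potential phi g) (potential psi g x).
Proof.
move=> gL aphi apsi dphi hx.
have [C C0 hC] := admissible_dom apsi hx.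
pose dl := x 0 ord_max / 2.
have dl0 : 0 < dl by rewrite divr_gt0.
have nearh (h : R) : `]- dl, dl[%classic h -> near_pt x (h *: e_ i + x).
  rewrite /= in_itv/= => hh j.
  rewrite !mxE eqxx opprD addrC -addrA addNr addr0 normrN.
  case: (j == i); last by rewrite mulr0 normr0 ltW.
  by rewrite mulr1 ltW// ltr_norml.
have halfh h : `]- dl, dl[%classic h -> half_space (h *: e_ i + x).
  by move=> /nearh; exact: near_ptW.
pose f (h : R) (y : bdry) := phi (h *: e_ i + x - bdry_point y) * g y.
have df h y : `]- dl, dl[%classic h ->
    is_derive h 1 (f ^~ y) (psi (h *: e_ i + x - bdry_point y) * g y).
  move=> hh.
  have hs : half_space (h *: e_ i + (x - bdry_point y)).
    by rewrite addrA; apply: half_space_sub; exact: halfh.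
  have d1 := is_derive_alongline (dphi _ hs).
  have -> : f ^~ y =
      (fun t : R => phi (t *: e_ i + (x - bdry_point y))) * cst (g y).
    by apply/funext => t; rewrite /f -addrA.
  apply: is_derive_eq (is_deriveM d1 (is_derive_cst (g y) h 1)) _.
  by rewrite scaler0 add0r -addrA [_ *: _]mulrC.
have I0 : `]- dl, dl[%classic (0 : R) by rewrite /= in_itv/= oppr_lt0 dl0.
have intf h : `]- dl, dl[%classic h -> lebt.-integrable setT (EFin \o f h).
  by move=> hh; apply: L2_integrable => //; apply: admissible_L2 => //; exact: halfh.
pose G y := `|C * decay x y * g y|.
have intG : lebt.-integrable setT (EFin \o G).
  apply: integrable_norm; rewrite /comp.
  under eq_fun do rewrite -mulrA EFinM.
  apply: integrableZl => //.
  by apply: L2_integrable => //; exact: decay_L2.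
have derf (h : R) y : `]- dl, dl[%classic h -> setT y -> derivable (f ^~ y) h 1.
  by move=> hh _; have [] := df h y hh.
have d1E (h : R) y : `]- dl, dl[%classic h ->
    partial1of2 f h y = psi (h *: e_ i + x - bdry_point y) * g y.
  by move=> hh; rewrite partial1of2E; have [] := df h y hh.
have ub (h : R) y : `]- dl, dl[%classic h -> setT y -> `|partial1of2 f h y| <= G y.
  move=> hh _; rewrite d1E// /G !normrM ler_wpM2r//.
  rewrite (ger0_norm C0) (ger0_norm (decay_ge0 x y)).
  by apply: hC; exact: nearh.
have cvgL := @cvg_differentiation_under_integral R _ _ lebt f setT measurableT 0 _ _
  I0 intf derf G (fun y => normr_ge0 _) intG ub.
have LE : \int[lebt]_(y in setT) partial1of2 f 0 y = potential psi g x.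
  by apply: eq_Rintegral => y _; rewrite d1E// scale0r add0r.
apply: is_derive_fromline.
have cv : (fun h : R =>
    h^-1 *: (((fun h : R => potential phi g (h *: e_ i + x)) \o shift 0) (h *: 1)
             - potential phi g (0 *: e_ i + x))) @ 0^' --> potential psi g x.
  rewrite -LE; apply: cvg_trans cvgL; apply: near_eq_cvg.
  by apply: nearW => h /=; rewrite [h *: (1:R)]mulr1 !addr0.
by split; [apply/cvg_ex; exists (potential psi g x)|exact/cvg_lim].
Qed.

(** If continuity failed there would be points converging to x, all in the
    neighbourhood where [phi] is dominated, at which the potential stays away
    from its value at x; this contradicts dominated convergence. *)
Lemma continuous_potential g phi x : g \in L2 -> admissible phi ->
  half_space x ->
  {for x, continuous (potential phi g)}.
Proof.
move=> gL aphi hx.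
have [C C0 hC] := admissible_dom aphi hx.
apply/(@cvgrPdist_le _ R^o _ (nbhs x) (nbhs_filter x)) => /= eps eps0.
apply: contrapT => nnear.
(* The first radius keeps the points in [near_pt x]; the second makes them converge. *)
pose rad (k : nat) : R := Num.min (x 0 ord_max / 2) k.+1%:R^-1.
have rad0 k : 0 < rad k by rewrite lt_min divr_gt0//= invr_gt0.
have /choice[z zP] : forall k, exists z, ball x (rad k) z /\
    eps < `|potential phi g x - potential phi g z|.
  move=> k; apply: contrapT => /forallNP h; apply: nnear.
  apply/nbhs_ballP; exists (rad k); first exact: rad0.
  by move=> z xz; rewrite leNgt; apply/negP => ez; apply: (h z).
have nz k : near_pt x (z k).
  move=> i; have [[_ /(_ 0 i)] + _] := zP k.
  rewrite /ball/= => /ltW/le_trans; apply.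
  by rewrite ge_min lexx.
have hz k : half_space (z k) by exact: near_ptW (nz k).
have zx : z @ \oo --> x.
  apply/cvg_ballP => e e0.
  near=> k; have [+ _] := zP k; apply: le_ball.
  apply: (@le_trans _ _ k.+1%:R^-1); first by rewrite ge_min lexx orbT.
  by near: k; apply: filterS (near_infty_natSinv_lt (PosNum e0)) => k /ltW.
have mz (w : point) : half_space w ->
    measurable_fun setT (fun y => (phi (w - bdry_point y) * g y)%:E).
  move=> hw; apply/measurable_EFinP; apply: measurable_funM.
    exact: adm_measurable.
  exact: (L2_measurable gL).
have intG : lebt.-integrable setT (EFin \o (fun y => `|C * decay x y * g y|)).
  apply: integrable_norm; rewrite /comp.
  under eq_fun do rewrite -mulrA EFinM.
  apply: integrableZl => //.
  by apply: L2_integrable => //; exact: decay_L2.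
have ptw y : (phi (z k - bdry_point y) * g y)%:E @[k --> \oo] -->
    (phi (x - bdry_point y) * g y)%:E.
  apply: cvg_EFin; first exact: nearW.
  apply: cvgM; last exact: cvg_cst.
  have c1 : (fun k => z k - bdry_point y) @ \oo --> x - bdry_point y.
    exact: (cvgB zx (cvg_cst _)).
  have c2 := adm_continuous aphi (half_space_sub y hx).
  exact: (cvg_comp _ _ c1 c2).
have ub y (k : nat) : setT y ->
    (`|(phi (z k - bdry_point y) * g y)%:E| <= `|C * decay x y * g y|%:E)%E.
  move=> _; rewrite lee_fin !normrM ler_wpM2r//.
  by rewrite (ger0_norm C0) (ger0_norm (decay_ge0 x y)); exact: hC.
have [_ _ cvgi] := @dominated_convergence _ _ _ lebt setT measurableT
  (fun k y => (phi (z k - bdry_point y) * g y)%:E)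
  (fun y => (phi (x - bdry_point y) * g y)%:E)
  (EFin \o (fun y => `|C * decay x y * g y|))
  (fun k => mz _ (hz k)) (mz _ hx) (aeW _ (fun y _ => ptw y)) intG
  (aeW _ ub).
have intp w : half_space w ->
    (\int[lebt]_y (phi (w - bdry_point y) * g y)%:E)%E =
    (potential phi g w)%:E.
  move=> hw; rewrite /potential /Rintegral fineK//.
  by apply: integrable_fin_num => //; apply: L2_integrable => //; exact: admissible_L2.
move: cvgi; rewrite intp//; under eq_fun do rewrite intp//.
move/fine_cvgP => [_ /cvgrPdist_le /(_ _ eps0)] /= [N _ /(_ N (leqnn N))] /=.
by have [_] := zP N; rewrite ltNge => /negP.
Unshelve. all: end_near. Qed.

End potentials.

(** * Poisson integrals of square-integrable functions *)

Section real_integrals.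
Context d (T : measurableType d) {R : realType} (mu : {measure set T -> \bar R}).

Lemma Rintegral_sum (I : Type) (r : seq I) (F : I -> T -> R) :
  (forall i, mu.-integrable setT (EFin \o F i)) ->
  \int[mu]_y (\sum_(i <- r) F i y) = \sum_(i <- r) \int[mu]_y F i y.
Proof.
move=> intF.
elim: r => [|i r IH].
  rewrite big_nil; under eq_Rintegral do rewrite big_nil.
  by rewrite /Rintegral integral0.
rewrite big_cons -IH -RintegralD//.
  by apply: eq_Rintegral => y _; rewrite big_cons.
have : forall s : seq I,
    mu.-integrable setT (EFin \o (fun y => \sum_(i <- s) F i y)).
  elim=> [|j s IHs].
    rewrite (_ : _ \o _ = cst 0%E); first exact: integrable0.
    by apply/funext => y /=; rewrite big_nil.
  have -> : EFin \o (fun y => \sum_(i <- j :: s) F i y) =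
      ((EFin \o F j) \+ (EFin \o (fun y => (\sum_(i <- s) F i y)%R)))%E.
    by apply/funext => y /=; rewrite big_cons EFinD.
    exact: integrableD.
exact.
Qed.

Lemma integrable_scale (a : R) (f : T -> R) :
  mu.-integrable setT (EFin \o f) ->
  mu.-integrable setT (EFin \o (fun y => a * f y)).
Proof. by move=> fi; exact: (integrableZl measurableT a fi). Qed.

End real_integrals.

Section poisson_integrals.
Context {R : realType} {m : nat}.
Hypothesis m0 : (0 < m)%N.
Notation point := 'rV[R]_m.+1.
Notation bdry := (m.-tuple (measurableTypeR R)).
Notation e_ i := (delta_mx 0 i : point).
Notation lebt := (lebesgue_tuple R m).
Notation L2 := (Lfun lebt 2%:E).
Implicit Types (u x z : point) (i j l : 'I_m.+1) (y : bdry).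
Implicit Types (phi psi : point -> R) (g : bdry -> R).

Lemma potential_lin g phi psi x (a b : R) : g \in L2 -> half_space x ->
  admissible phi -> admissible psi ->
  potential (fun u => a * phi u + b * psi u) g x =
  a * potential phi g x + b * potential psi g x.
Proof.
move=> gL hx aphi apsi.
have i1 := L2_integrable (admissible_L2 m0 aphi hx) gL.
have i2 := L2_integrable (admissible_L2 m0 apsi hx) gL.
have i3 := integrable_scale a i1.
have i4 := integrable_scale b i2.
rewrite /potential -!RintegralZl// -RintegralD//.
by apply: eq_Rintegral => y _; rewrite !mulrA mulrDl.
Qed.

Lemma poisson_potential g x :
  poisson_integral g x = 2 / omega m.+1 * potential poisson_kernel g x.
Proof.
congr (_ * _); apply: eq_Rintegral => y _.
by rewrite /poisson_kernel /mon big_seq1 coord_last_sub -enormN opprB.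
Qed.

Lemma nbhs_half_space x : half_space x -> nbhs x (@half_space R m).
Proof.
move=> hx.
exact: (@continuous_coord R m x ord_max _ (lt_nbhsr hx)).
Qed.

Lemma near_eq_half_space (f h : point -> R) x : half_space x ->
  (forall z, half_space z -> f z = h z) -> \near x, f x = h x.
Proof.
by move=> hx fh; apply: filterS (nbhs_half_space hx) => z /fh.
Qed.

Lemma near_eq_continuous (f h : point -> R) x : half_space x ->
  (forall z, half_space z -> f z = h z) ->
  {for x, continuous f} -> {for x, continuous h}.
Proof.
move=> hx fh cf.
rewrite /prop_for /continuous_at -(fh _ hx).
have fhx := near_eq_half_space hx fh.
exact: (cvg_trans (@near_eq_cvg _ _ (nbhs x) (nbhs_filter x) f h fhx) cf).
Qed.

Let c : R := 2 / omega m.+1.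

Lemma is_derive_poisson g i x : g \in L2 -> half_space x ->
  is_derive x (e_ i) (poisson_integral g) (c * potential (dpoisson_kernel i) g x).
Proof.
move=> gL hx.
have -> : poisson_integral g = c *: (potential poisson_kernel g : point -> R).
  by apply/funext => z; rewrite poisson_potential.
apply: is_deriveZ; apply: is_derive_potential => //.
- exact: admissible_poisson_kernel.
- exact: admissible_dpoisson_kernel.
- by move=> u; exact: is_derive_poisson_kernel.
Qed.

Lemma partial_poisson g i x : g \in L2 -> half_space x ->
  c * potential (dpoisson_kernel i) g x = partial i (poisson_integral g) x.
Proof. by move=> gL hx; have [_ <-] := is_derive_poisson i gL hx. Qed.

Lemma is_derive_partial_poisson g i j x : g \in L2 -> half_space x ->
  is_derive x (e_ j) (partial i (poisson_integral g))
    (c * potential (ddpoisson_kernel j i) g x).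
Proof.
move=> gL hx.
apply: (@near_eq_is_derive _ _ _ (c *: (potential (dpoisson_kernel i) g : point -> R))).
  apply: near_eq_half_space => // z hz; exact: partial_poisson.
apply: is_deriveZ; apply: is_derive_potential => //.
- exact: admissible_dpoisson_kernel.
- exact: admissible_ddpoisson_kernel.
- by move=> u; exact: is_derive_dpoisson_kernel.
Qed.

Lemma partial2_poisson g i j x : g \in L2 -> half_space x ->
  c * potential (ddpoisson_kernel j i) g x =
  partial j (partial i (poisson_integral g)) x.
Proof. by move=> gL hx; have [_ <-] := is_derive_partial_poisson i j gL hx. Qed.

Lemma continuous_scaled_potential g phi x : g \in L2 -> admissible phi ->
  half_space x ->
  {for x, continuous (fun z => c * potential phi g z)}.
Proof.
move=> gL aphi hx; apply: continuousM; first exact: cst_continuous.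
exact: continuous_potential.
Qed.

Lemma harmonic_poisson g : g \in L2 ->
  harmonic_on (@half_space R m) (poisson_integral g).
Proof.
move=> gL; split.
  move=> x hx i j; split.
  - by have [] := is_derive_poisson i gL hx.
  - apply: (near_eq_continuous hx (fun z => partial_poisson i gL (x := z))).
    by apply: continuous_scaled_potential => //; exact: admissible_dpoisson_kernel.
  - by have [] := is_derive_partial_poisson j i gL hx.
  - apply: (near_eq_continuous hx (fun z => partial2_poisson j i gL (x := z))).
    by apply: continuous_scaled_potential => //; exact: admissible_ddpoisson_kernel.
move=> x hx.
under eq_bigr do rewrite -partial2_poisson//.
rewrite -mulr_sumr /potential -Rintegral_sum; last first.
  move=> i; apply: L2_integrable => //; apply: admissible_L2 => //.
  exact: admissible_ddpoisson_kernel.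
under eq_Rintegral => y _.
  rewrite -mulr_suml laplacian_poisson_kernel ?mul0r; last exact: half_space_sub.
  over.
by rewrite /Rintegral integral0 mulr0.
Qed.

Lemma h2_poisson g : g \in L2 -> h2_with_boundary (poisson_integral g) g.
Proof. by move=> gL; split => //; exact: harmonic_poisson. Qed.

(** The kernel of the i-th derivative of x_n^(n alpha - 1) v(x), up to the factor
    2 n x_n^(n alpha - 1) / omega_n, written as a function of u = x - (y, 0). *)
Definition grad_kernel (alpha : R) i u : R :=
  ((i == ord_max)%:R * alpha) * mon [::] m.+1 u +
  (- 1) * mon [:: ord_max; i] m.+3 u.

Lemma admissible_grad_kernel alpha i : admissible (grad_kernel alpha i).
Proof. by apply: admissibleD; apply: admissibleZ; exact: admissible_mon. Qed.

(** The derivative of the weight contributes (n alpha - 1) / |u|^n to the normal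
    component; added to the term 1 / |u|^n of the differentiated Poisson kernel
    this gives n alpha / |u|^n. *)
Lemma is_derive_weighted alpha v g x i : h2_with_boundary v g -> half_space x ->
  is_derive x (e_ i) (fun z : point => z 0 ord_max `^ (m.+1%:R * alpha - 1) * v z)
    (2 * m.+1%:R / omega m.+1 * x 0 ord_max `^ (m.+1%:R * alpha - 1) *
       potential (grad_kernel alpha i) g x).
Proof.
move=> [gL _ vE] hx; set b := _ - 1.
have xn0 : 0 < x 0 ord_max by [].
apply: (@near_eq_is_derive _ _ _
  ((fun z : point => z 0 ord_max `^ b : R) * (poisson_integral g : point -> R))).
  by apply: near_eq_half_space => // z hz; rewrite vE.
have d1 := is_derive_comp1 (is_derive1_powR b xn0) (is_derive_coord x i ord_max).
apply: is_derive_eq (is_deriveM d1 (is_derive_poisson i gL hx)) _.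
have a0 : admissible (mon [::] m.+1 : point -> R) by exact: admissible_mon.
have a2 : admissible (mon [:: ord_max; i] m.+3 : point -> R) by exact: admissible_mon.
rewrite poisson_potential -/c.
have -> : potential poisson_kernel g x = x 0 ord_max * potential (mon [::] m.+1) g x.
  rewrite /potential -RintegralZl//.
    apply: eq_Rintegral => y _.
    by rewrite /poisson_kernel /mon big_seq1 big_nil coord_last_sub; ring.
  by apply: L2_integrable => //; exact: admissible_L2.
have -> : potential (dpoisson_kernel i) g x =
   (i == ord_max)%:R * potential (mon [::] m.+1) g x +
   (- m.+1%:R) * potential (mon [:: ord_max; i] m.+3) g x.
  rewrite -potential_lin//; apply: eq_Rintegral => y _; congr (_ * _).
  by rewrite /dpoisson_kernel mulNr.
rewrite potential_lin// -/c.
have -> : x 0 ord_max `^ b = x 0 ord_max * x 0 ord_max `^ (b - 1).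
  rewrite -{1}(subrK 1 b) powRD; last by rewrite (gt_eqF xn0) implybT.
  by rewrite powRr1 ?ltW// mulrC.
by rewrite /GRing.scale/= /c /b; ring.
Qed.

End poisson_integrals.

(** * The Gram matrix of the gradient kernels *)

Section gram.
Context {R : realType} {m : nat}.
Hypothesis m0 : (0 < m)%N.
Notation point := 'rV[R]_m.+1.
Notation bdry := (m.-tuple (measurableTypeR R)).
Notation lebt := (lebesgue_tuple R m).
Notation wide := (widen_ord (leqnSn m)).
Notation gauss_moment := (@gauss_moment R).

(** The reflection exchanges the positive and negative parts of f. *)
Lemma Rintegral_flip_odd (i : 'I_m) (c : R) (f : bdry -> R) :
  measurable_fun setT f -> (forall t, f (flip i c t) = - f t) ->
  \int[lebt]_t f t = 0.
Proof.
move=> mf oddf; rewrite /Rintegral integralE.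
have mef : measurable_fun setT (EFin \o f) by exact/measurable_EFinP.
have -> : (\int[lebt]_t (EFin \o f)^\+ t = \int[lebt]_t (EFin \o f)^\- t)%E.
  rewrite -(ge0_integral_flip i c)//; last exact: measurable_funepos.
  by apply: eq_integral => t _; rewrite funeposE funenegE /= oddf.
by case: (integral _ _ _) => [r| |] //=; rewrite subrr.
Qed.

Lemma coord_wide_sub (x : point) (y : bdry) (j : 'I_m) :
  (x - bdry_point y) 0 (wide j) = x 0 (wide j) - tnth y j.
Proof. by rewrite 2!mxE bdry_point_widen. Qed.

Lemma flip_coord (x : point) (i : 'I_m) (y : bdry) (l : 'I_m.+1) :
  (x - bdry_point (flip i (x 0 (wide i)) y)) 0 l =
  (-1) ^+ (l == wide i) * (x - bdry_point y) 0 l.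
Proof.
case: (unliftP ord_max l) => [j ->|->]; last first.
  by rewrite !coord_last_sub -val_eqE/= gtn_eqF// mul1r.
rewrite lift_max_widen.
have wide_inj : injective wide by move=> a b /(congr1 val)/= e; exact/val_inj.
rewrite (inj_eq wide_inj) !coord_wide_sub tnth_mktuple.
case: eqVneq => [->|_]; last by rewrite mul1r.
by rewrite expr1; ring.
Qed.

Lemma flip_enorm (x : point) (i : 'I_m) (y : bdry) :
  enorm (x - bdry_point (flip i (x 0 (wide i)) y)) = enorm (x - bdry_point y).
Proof.
congr Num.sqrt; apply: eq_bigr => l _.
by rewrite flip_coord exprMn -exprM mulnC exprM sqrrN expr1n expr1n mul1r.
Qed.

Lemma grad_kernel_flip alpha (x : point) (i : 'I_m) (y : bdry) (l : 'I_m.+1) :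
  grad_kernel alpha l (x - bdry_point (flip i (x 0 (wide i)) y)) =
  (-1) ^+ (l == wide i) * grad_kernel alpha l (x - bdry_point y).
Proof.
have nmax : (ord_max == wide i) = false by rewrite -val_eqE/= gtn_eqF.
rewrite /grad_kernel /mon !(big_cons, big_nil) flip_enorm !flip_coord nmax.
have [->|_] := eqVneq l (wide i); last by rewrite !mul1r.
by rewrite [wide i == ord_max]eq_sym nmax expr1 expr0 mulr0n; ring.
Qed.

(** One of the two indices is tangential, and the product is odd under the
    reflection of that coordinate about x. *)
Lemma grad_kernel_orthogonal alpha (x : point) (i j : 'I_m.+1) : i != j ->
  \int[lebt]_y (grad_kernel alpha i (x - bdry_point y) *
                grad_kernel alpha j (x - bdry_point y)) = 0.
Proof.
have oneside (k : 'I_m) l : l != wide k ->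
  \int[lebt]_y (grad_kernel alpha (wide k) (x - bdry_point y) *
                grad_kernel alpha l (x - bdry_point y)) = 0.
  move=> lk; apply: (@Rintegral_flip_odd k (x 0 (wide k))).
    by apply: measurable_funM; apply: adm_measurable; exact: admissible_grad_kernel.
  by move=> y; rewrite !grad_kernel_flip eqxx (negbTE lk); ring.
case: (unliftP ord_max i) => [k ->|->]; first by rewrite lift_max_widen eq_sym; exact: oneside.
case: (unliftP ord_max j) => [k ->|->]; last by rewrite eqxx.
rewrite lift_max_widen => h; under eq_Rintegral do rewrite mulrC.
exact: oneside.
Qed.

(** The integral of 1 / |x - y|^(2n) over the boundary when x is at height one. *)
Definition mass : R := Num.sqrt pi ^+ m * gauss_moment m.+1 / gauss_moment m.*2.+1.

Lemma mass_gt0 : 0 < mass.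
Proof.
rewrite divr_gt0 ?gauss_moment_gt0// mulr_gt0 ?gauss_moment_gt0// exprn_gt0//.
by rewrite sqrtr_gt0 pi_gt0.
Qed.

Let gpos j : gauss_moment j != 0. Proof. by rewrite gt_eqF// gauss_moment_gt0. Qed.

Section moments.
Variable x : point.
Hypothesis hx : half_space x.
Let h := x 0 ord_max.
Let h0 : 0 < h. Proof. exact: hx. Qed.

Lemma integral_enormV (p : nat) : (m <= p.*2.+1)%N ->
  \int[lebt]_y (enorm (x - bdry_point y) ^+ p.+1.*2)^-1 =
  Num.sqrt pi ^+ m * gauss_moment (p.*2.+1 - m) /
  (gauss_moment p.*2.+1 * h ^+ (p.*2.+2 - m)).
Proof.
move=> mp; rewrite /Rintegral.
have := @integral_tuple_radial R m (fun=> 0%N) (fun i : 'I_m => x 0 (wide i)) _ p h0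
  (fun=> isT).
rewrite /= sum1_card card_ord => /(_ mp).
under eq_integral => y _.
  rewrite big1 ?mul1r; last by move=> i _; rewrite expr0.
  rewrite -sqr_enorm_bdry -exprM mul2n.
  over.
move=> ->/=; rewrite prodr_const card_ord; congr (_ ^+ _ * _ / _).
by rewrite /gauss_moment; field.
Qed.

Lemma integral_coord_enormV (i : 'I_m) :
  \int[lebt]_y ((x - bdry_point y) 0 (wide i) ^+ 2 /
     enorm (x - bdry_point y) ^+ m.+3.*2) =
  mass / (4 * m.+1%:R) / h ^+ m.+4.
Proof.
rewrite /Rintegral.
have ev j : ~~ odd (if j == i then 2 else 0%N) by case: ifP.
have mle : (m.+2 <= m.+2.*2.+1)%N by rewrite -addnn -addSn leq_addl.
have := @integral_tuple_radial R m (fun j => if j == i then 2 else 0%N)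
  (fun i : 'I_m => x 0 (wide i)) _ m.+2 h0 ev.
have -> : (\sum_(j < m) (if j == i then 2 else 0).+1 = m.+2)%N.
  rewrite (bigD1 i)//= eqxx (eq_bigr (fun=> 1%N)); last by move=> j /negbTE ->.
  rewrite sum1_card cardC1 card_ord.
  by rewrite -[in RHS](prednK m0).
move=> /(_ mle) H.
rewrite (eq_integral (fun t : bdry => (\prod_(j < m)
          (tnth t j - x 0 (wide j)) ^+ (if j == i then 2 else 0%N) /
       (h ^+ 2 + \sum_(j < m) (tnth t j - x 0 (wide j)) ^+ 2) ^+ m.+3)%:E)); last first.
  move=> y _; congr EFin.
  rewrite (bigD1 i)//= eqxx big1 ?mulr1; last by move=> j /negbTE ->; rewrite expr0.
  by rewrite -sqr_enorm_bdry -exprM mul2n coord_wide_sub -sqrrN opprB.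
rewrite H/=.
rewrite (bigD1 i)//= eqxx (eq_bigr (fun=> Num.sqrt pi)); last first.
  by move=> j /negbTE ->; rewrite /gauss_moment; field.
rewrite prodr_const cardC1 card_ord.
have -> : (m.+2.*2.+1 - m.+2 = m.+3)%N by rewrite -addnn -addnS addKn.
have -> : (m.+2.*2.+2 - m.+2 = m.+4)%N by rewrite -addnn -!addnS addKn.
rewrite /mass -[in Num.sqrt pi ^+ m](prednK m0) [Num.sqrt pi ^+ m.-1.+1]exprS.
rewrite !doubleS !gauss_momentSS -!muln2.
have g1 := gpos (m * 2).+1.
have e0 : 2 * gauss_moment 0 = Num.sqrt pi by rewrite /gauss_moment; field.
rewrite -e0; field.
by rewrite g1 ?expf_neq0 ?gt_eqF//=.
Qed.

(** The square of the kernel is x_n^2 u_i^2 / |u|^(2n+4). *)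
Lemma integral_tangent_kernel_sqr alpha (i : 'I_m) :
  \int[lebt]_y (grad_kernel alpha (wide i) (x - bdry_point y) ^+ 2) =
  mass / (4 * m.+1%:R) / h ^+ m.+2.
Proof.
have nmax : (wide i == ord_max) = false by rewrite -val_eqE/= ltn_eqF.
have admE : (fun y : bdry => mon [:: wide i] m.+3 (x - bdry_point y)) \in Lfun lebt 2%:E.
  by apply: admissible_L2 => //; apply: admissible_mon; rewrite add1n ltnS !leqW.
transitivity (\int[lebt]_y (h ^+ 2 * ((x - bdry_point y) 0 (wide i) ^+ 2 /
     enorm (x - bdry_point y) ^+ m.+3.*2))).
  apply: eq_Rintegral => y _.
  rewrite /grad_kernel nmax mul0r mul0r add0r /mon !(big_cons, big_nil) coord_last_sub.
  rewrite -/h -[m.+3.*2]muln2 [enorm _ ^+ (_ * 2)]exprM.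
  have r0 : enorm (x - bdry_point y) != 0.
    by rewrite gt_eqF// half_space_enorm_gt0//; exact: half_space_sub.
  by field; rewrite expf_neq0.
rewrite RintegralZl//.
  rewrite integral_coord_enormV.
  by rewrite -[m.+4]/(2 + m.+2)%N exprD; field; rewrite ?expf_neq0 ?gt_eqF.
have := L2_integrable admE admE; congr (_ .-integrable _ _).
apply/funext => y /=; congr EFin.
by rewrite /mon big_seq1 -muln2 exprM expr2; field; rewrite expf_neq0// gt_eqF//
  half_space_enorm_gt0//; exact: half_space_sub.
Qed.

(** The kernel is alpha |u|^(-n) - x_n^2 |u|^(-n-2), whose square is a combination
    of three powers of |u|. *)
Lemma integral_normal_kernel_sqr alpha :
  \int[lebt]_y (grad_kernel alpha ord_max (x - bdry_point y) ^+ 2) =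
  mass / m.+1%:R * (m.+1%:R * alpha ^+ 2 - (m.+1%:R + 1) * alpha +
    (m.+1%:R + 3) / 4) / h ^+ m.+2.
Proof.
have rp y : enorm (x - bdry_point y) != 0.
  by rewrite gt_eqF// half_space_enorm_gt0//; exact: half_space_sub.
have monL (p : nat) : (m <= p)%N ->
    (fun y : bdry => mon [::] p (x - bdry_point y)) \in Lfun lebt 2%:E.
  by move=> mp; apply: admissible_L2 => //; exact: admissible_mon.
have int (p q : nat) : (m <= p)%N -> (m <= q)%N -> lebt.-integrable setT
    (EFin \o (fun y => (enorm (x - bdry_point y) ^+ (p + q))^-1)).
  move=> mp mq; have := L2_integrable (monL _ mp) (monL _ mq).
  congr (_ .-integrable _ _); apply/funext => y /=; congr EFin.
  by rewrite /mon !big_nil exprD; field; rewrite !expf_neq0.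
have i1 := int m.+1 m.+1 (leqnSn _) (leqnSn _).
have i2 := int m.+1 m.+3 (leqnSn _) (leqW (leqW (leqnSn _))).
have i3 := int m.+3 m.+3 (leqW (leqW (leqnSn _))) (leqW (leqW (leqnSn _))).
have e1 : (m.+1 + m.+1 = m.+1.*2)%N by rewrite addnn.
have e2 : (m.+1 + m.+3 = m.+2.*2)%N by rewrite -addnn !addnS !addSn.
have e3 : (m.+3 + m.+3 = m.+3.*2)%N by rewrite addnn.
rewrite e1 in i1; rewrite e2 in i2; rewrite e3 in i3.
transitivity (\int[lebt]_y (alpha ^+ 2 * (enorm (x - bdry_point y) ^+ m.+1.*2)^-1 +
   ((- 2 * alpha * h ^+ 2) * (enorm (x - bdry_point y) ^+ m.+2.*2)^-1 +
   h ^+ 4 * (enorm (x - bdry_point y) ^+ m.+3.*2)^-1))).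
  apply: eq_Rintegral => y _.
  rewrite /grad_kernel eqxx mul1r /mon !(big_cons, big_nil) coord_last_sub.
  rewrite -/h -e1 -e2 -e3 !exprD.
  by field; rewrite !expf_neq0.
have j1 := integrable_scale (alpha ^+ 2) i1.
have j2 := integrable_scale (- 2 * alpha * h ^+ 2) i2.
have j3 := integrable_scale (h ^+ 4) i3.
rewrite RintegralD//; last exact: (integrableD measurableT j2 j3).
rewrite RintegralD// !RintegralZl//.
rewrite !integral_enormV; last 3 first.
- by rewrite !doubleS -addnn -!addnS leq_addr.
- by rewrite !doubleS -addnn -!addnS leq_addr.
- by rewrite -addnn -!addnS leq_addr.
have -> : (m.*2.+1 - m = m.+1)%N by rewrite -addnn -addnS addKn.
have -> : (m.*2.+2 - m = m.+2)%N by rewrite -addnn -!addnS addKn.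
have -> : (m.+1.*2.+1 - m = m.+3)%N by rewrite doubleS -addnn -!addnS addKn.
have -> : (m.+1.*2.+2 - m = m.+4)%N by rewrite doubleS -addnn -!addnS addKn.
have -> : (m.+2.*2.+1 - m = m.+1.+4)%N by rewrite !doubleS -addnn -!addnS addKn.
have -> : (m.+2.*2.+2 - m = m.+2.+4)%N by rewrite !doubleS -addnn -!addnS addKn.
rewrite /mass !doubleS !gauss_momentSS -!muln2.
have g1 := gpos (m * 2).+1.
rewrite !(exprS h) expr0.
by field; rewrite g1 ?expf_neq0 ?gt_eqF//=.
Qed.

Lemma integral_grad_kernel_sqr alpha (i : 'I_m.+1) :
  \int[lebt]_y (grad_kernel alpha i (x - bdry_point y) ^+ 2) =
  mass / m.+1%:R * (if i == ord_max
    then m.+1%:R * alpha ^+ 2 - (m.+1%:R + 1) * alpha + (m.+1%:R + 3) / 4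
    else 1 / 4) / h ^+ m.+2.
Proof.
case: (unliftP ord_max i) => [k ->|->]; last by rewrite eqxx integral_normal_kernel_sqr.
rewrite lift_max_widen.
rewrite integral_tangent_kernel_sqr ifF; last by rewrite -val_eqE/= ltn_eqF.
by field; rewrite ?expf_neq0 ?gt_eqF.
Qed.

End moments.

(** Gamma(n/2) is twice the moment of order m, so this is the duplication
    formula. *)
Lemma mass_omega : (1 < m)%N -> mass = omega m.+1 / 2 ^+ m.+1.
Proof.
move=> m1; rewrite /mass /omega powR_half ?pi_ge0//.
rewrite (_ : Gamma _ = 2 * gauss_moment m); last first.
  by case: m m1 => [|[|j]]// _; exact: Gamma_half.
have : gauss_moment m.+1 =
    Num.sqrt pi * gauss_moment m.*2.+1 / (gauss_moment m * 2 ^+ m.+1).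
  rewrite -gauss_moment_duplication; field.
  by rewrite gpos ?expf_neq0 ?gt_eqF.
move=> ->; rewrite [Num.sqrt pi ^+ _.+1]exprS; field.
by rewrite !gpos ?expf_neq0 ?gt_eqF.
Qed.

End gram.

(** * Sharp bounds for the gradient and its components *)

Section sharp.
Context {R : realType} {m : nat}.
Hypothesis m1 : (1 < m)%N.
Variables (alpha : R) (x : 'rV[R]_m.+1).
Hypothesis hx : half_space x.
Notation point := 'rV[R]_m.+1.
Notation bdry := (m.-tuple (measurableTypeR R)).
Notation lebt := (lebesgue_tuple R m).
Notation L2 := (Lfun lebt 2%:E).
Let m0 : (0 < m)%N. Proof. exact: ltnW. Qed.
Let h := x 0 ord_max.
Let h0 : 0 < h. Proof. exact: hx. Qed.

Let weighted (v : point -> R) : point -> R :=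
  fun z => z 0 ord_max `^ (m.+1%:R * alpha - 1) * v z.

Let ek i (y : bdry) := grad_kernel alpha i (x - bdry_point y).
Let q g i := \int[lebt]_y (ek i y * g y).
Let K := 2 * m.+1%:R / omega m.+1 * h `^ (m.+1%:R * alpha - 1).

Let omega_gt0 : 0 < omega m.+1 :> R.
Proof.
have o0 := @mass_gt0 R m; rewrite (@mass_omega R m m1) in o0.
by have := mulr_gt0 o0 (exprn_gt0 m.+1 (ltr0Sn R 1)); rewrite divfK// expf_neq0.
Qed.

Let K_gt0 : 0 < K.
Proof. by rewrite mulr_gt0 ?powR_gt0// divr_gt0// mulr_gt0// ltr0n. Qed.

Let ekL i : ek i \in L2.
Proof. by apply: admissible_L2 => //; exact: admissible_grad_kernel. Qed.

Lemma partial_weighted v g i : h2_with_boundary v g ->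
  partial i (weighted v) x = K * q g i.
Proof. by move=> vg; have [_] := is_derive_weighted m0 alpha i vg hx. Qed.

(** The squared norm of the i-th gradient kernel up to a factor independent of i,
    see [integral_grad_kernel_sqr]. *)
Definition energy (i : 'I_m.+1) : R := if i == ord_max
  then m.+1%:R * alpha ^+ 2 - (m.+1%:R + 1) * alpha + (m.+1%:R + 3) / 4 else 1 / 4.

(** The quadratic polynomial in alpha has discriminant 1 - n < 0, made visible by
    completing the square. *)
Lemma energy_gt0 i : 0 < energy i.
Proof.
rewrite /energy; case: ifP => _; last by lra.
have n3 : 3 <= m.+1%:R :> R by rewrite ler_nat.
set n := m.+1%:R in n3 *.
have -> : n * alpha ^+ 2 - (n + 1) * alpha + (n + 3) / 4 =
  n * (alpha - (n + 1) / (2 * n)) ^+ 2 + (n - 1) / (4 * n).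
  by field; rewrite gt_eqF//; lra.
apply: ltr_wpDl; first by rewrite mulr_ge0 ?sqr_ge0//; lra.
by rewrite divr_gt0//; lra.
Qed.

Let N i := @mass R m / m.+1%:R * energy i / h ^+ m.+2.

Let normE i : L2norm (ek i) ^+ 2 = N i.
Proof. by rewrite L2norm_sqr// (integral_grad_kernel_sqr m0 hx). Qed.

(** Let W be the sum of the (g, E_i) E_i.  Then Q, the sum of the (g, E_i)^2, is
    the inner product of W and g, while by orthogonality |W|^2 <= M Q; so
    Cauchy-Schwarz gives Q <= sqrt(M Q) |g|. *)
Let bessel g (M : R) : g \in L2 -> (forall i, N i <= M) ->
  Num.sqrt (\sum_i q g i ^+ 2) <= Num.sqrt M * L2norm g.
Proof.
move=> gL NM.
pose W y := \sum_i q g i * ek i y.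
have intSS (f : bdry -> R) i : f \in L2 ->
    lebt.-integrable setT (EFin \o (fun y => q g i * (ek i y * f y))).
  by move=> fL; apply: integrable_scale; exact: L2_integrable.
have aW : admissible (fun u => \sum_i q g i * grad_kernel alpha i u).
  elim: (index_enum _) => [|i s IH].
    have := admissibleZ 0 (admissible_grad_kernel alpha (ord_max : 'I_m.+1)).
    congr admissible.
    by apply/funext => u; rewrite big_nil mul0r.
  have := admissibleD (admissibleZ (q g i) (admissible_grad_kernel alpha i)) IH.
  by congr admissible; apply/funext => u; rewrite big_cons.
have WL : W \in L2 by exact: (admissible_L2 m0 aW hx).
have Wg (f : bdry -> R) : f \in L2 ->
    \int[lebt]_y (W y * f y) = \sum_i q g i * \int[lebt]_y (ek i y * f y).
  move=> fL.
  under eq_Rintegral do rewrite /W mulr_suml.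
  under eq_Rintegral => y _ do under eq_bigr do rewrite -mulrA.
  rewrite Rintegral_sum//; last by move=> i; exact: intSS.
  by apply: eq_bigr => i _; rewrite RintegralZl//; exact: L2_integrable.
have WW : L2norm W ^+ 2 = \sum_i q g i ^+ 2 * N i.
  rewrite L2norm_sqr//; under eq_Rintegral do rewrite expr2.
  rewrite Wg//; apply: eq_bigr => i _; rewrite expr2 -mulrA; congr (_ * _).
  under eq_Rintegral do rewrite mulrC.
  rewrite Wg// (bigD1 i)//= big1 ?addr0 => [|j ji].
    by rewrite -normE L2norm_sqr//; under eq_Rintegral do rewrite -expr2.
  by rewrite /ek grad_kernel_orthogonal// mulr0.
set Q := \sum_i _.
have Q0 : 0 <= Q by rewrite sumr_ge0// => i _; rewrite sqr_ge0.
have M0 : 0 <= M by apply: le_trans (NM ord_max); rewrite -normE sqr_ge0.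
have QW : Q <= L2norm W * L2norm g.
  rewrite (_ : Q = \int[lebt]_y (W y * g y)).
    exact: le_trans (ler_norm _) (L2_cauchy_schwarz WL gL).
  by rewrite (Wg _ gL); apply: eq_bigr => i _; rewrite expr2.
have WM : L2norm W ^+ 2 <= M * Q.
  rewrite WW mulr_sumr; apply: ler_sum => i _.
  by rewrite mulrC ler_wpM2r ?sqr_ge0.
have WM' : L2norm W <= Num.sqrt M * Num.sqrt Q.
  rewrite -sqrtrM// -[leLHS]ger0_norm ?L2norm_ge0// -sqrtr_sqr.
  by rewrite ler_wsqrtr.
have [Qz|Qp] := eqVneq Q 0.
  by rewrite Qz sqrtr0 mulr_ge0 ?sqrtr_ge0 ?L2norm_ge0.
have sQ : 0 < Num.sqrt Q by rewrite sqrtr_gt0 lt_neqAle eq_sym Qp.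
rewrite -(ler_pM2r sQ) -expr2 sqr_sqrtr//.
apply: le_trans QW _; rewrite mulrAC ler_wpM2r ?L2norm_ge0//.
Qed.

Lemma grad_bound v g (M : R) : h2_with_boundary v g -> (forall i, N i <= M) ->
  enorm (grad (weighted v) x) <= K * Num.sqrt M * L2norm g.
Proof.
move=> vg NM; have [gL _ _] := vg.
have -> : enorm (grad (weighted v) x) = K * Num.sqrt (\sum_i q g i ^+ 2).
  rewrite -[K in RHS](ger0_norm (ltW K_gt0)) -sqrtr_sqr -sqrtrM ?sqr_ge0// mulr_sumr.
  congr Num.sqrt; apply: eq_bigr => i _.
  by rewrite mxE (partial_weighted i vg) exprMn.
by rewrite -mulrA; apply: ler_wpM2l; [exact: ltW|exact: bessel].
Qed.

Lemma partial_bound v g i : h2_with_boundary v g ->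
  `|partial i (weighted v) x| <= K * Num.sqrt (N i) * L2norm g.
Proof.
move=> vg; have [gL _ _] := vg.
rewrite (partial_weighted i vg) normrM (gtr0_norm K_gt0) -mulrA.
apply: ler_wpM2l; first exact: ltW.
apply: le_trans (L2_cauchy_schwarz (ekL i) gL) _.
by rewrite -normE sqrtr_sqr ger0_norm// L2norm_ge0.
Qed.

(** The inequality is tested on the Poisson integral of the kernel E_i itself, for
    which (E_i, g) = |E_i| |g|. *)
Lemma partial_sharp (F : (point -> R) -> R) (C : R) i :
  (forall v g, h2_with_boundary v g -> `|partial i (weighted v) x| <= F v) ->
  bounding_coef F C -> K * Num.sqrt (N i) <= C.
Proof.
move=> pF /(_ (poisson_integral (ek i)) (ek i) (h2_poisson m0 (ekL i))).
move=> /(le_trans (pF _ _ (h2_poisson m0 (ekL i)))).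
rewrite (partial_weighted i (h2_poisson m0 (ekL i))) => FC.
have N0 : 0 < N i.
  by rewrite /N divr_gt0 ?exprn_gt0// mulr_gt0 ?energy_gt0// divr_gt0// mass_gt0.
have qe : q (ek i) i = N i.
  by rewrite -normE L2norm_sqr//; apply: eq_Rintegral => y _; rewrite expr2.
have ne : L2norm (ek i) = Num.sqrt (N i).
  by rewrite -normE sqrtr_sqr ger0_norm// L2norm_ge0.
have sN : 0 < Num.sqrt (N i) by rewrite sqrtr_gt0.
rewrite -(ler_pM2r sN) -mulrA -expr2 sqr_sqrtr; last exact: ltW.
by move: FC; rewrite qe ne (gtr0_norm (mulr_gt0 K_gt0 N0)).
Qed.

(** With [mass_omega] the factor 2 n / omega_n enters the square root, and the
    exponent of x_n is (n alpha - 1) - (n + 1) / 2. *)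
Lemma grad_coefE i :
  K * Num.sqrt (N i) =
  Num.sqrt (m.+1%:R / (2 ^+ m.-1 * omega m.+1) * energy i) *
    h `^ (m.+1%:R * alpha - (m.+1%:R + 3) / 2).
Proof.
have sh0 : 0 < Num.sqrt h by rewrite sqrtr_gt0.
have -> : h `^ (m.+1%:R * alpha - (m.+1%:R + 3) / 2) =
    h `^ (m.+1%:R * alpha - 1) / Num.sqrt h ^+ m.+2.
  rewrite -powR_half ?ltW// -powRB; last by rewrite (gt_eqF h0) implybT.
  by congr (_ `^ _); rewrite -[m.+2]addn1 natrD; field.
have -> : N i = (@mass R m / m.+1%:R * energy i) * (Num.sqrt h ^+ m.+2)^-1 ^+ 2.
  by rewrite /N exprVn -exprM mulnC exprM sqr_sqrtr// ltW.
have q0 := energy_gt0 i.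
rewrite sqrtrM; last first.
  apply: mulr_ge0; last exact: ltW.
  rewrite (@mass_omega R m m1); apply: divr_ge0 => //.
  by apply: divr_ge0; [exact: ltW|exact: exprn_ge0].
rewrite sqrtr_sqr ger0_norm ?invr_ge0 ?exprn_ge0 ?ltW//.
rewrite /K [X in _ = X]mulrA [X in X = _]mulrA; congr (_ / _).
rewrite mulrAC; congr (_ * _).
have k0 : 0 <= 2 * m.+1%:R / omega m.+1 :> R.
  by apply: divr_ge0; [exact: mulr_ge0|exact: ltW].
rewrite -[X in X * _](ger0_norm k0) -sqrtr_sqr -sqrtrM ?sqr_ge0//.
congr Num.sqrt; rewrite (@mass_omega R m m1).
rewrite -[in 2 ^+ m.+1](prednK m0) !exprS.
by field; rewrite expf_neq0//= (gt_eqF omega_gt0)//= -[1%R]/(1%:R) -natrD pnatr_eq0.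
Qed.

(** The difference of the two energies is n (alpha - 1/2) (alpha - 1/2 - 1/n). *)
Lemma alpha_cond_energy : 0 <= alpha ->
  alpha_cond m.+1 alpha = (1 / 4 <= energy ord_max).
Proof.
move=> a0; rewrite /alpha_cond a0 /energy eqxx/=.
have n3 : 3 <= m.+1%:R :> R by rewrite ler_nat.
set n := m.+1%:R in n3 *.
have n0 : n != 0 by rewrite gt_eqF//; lra.
rewrite -subr_ge0.
have -> : n * alpha ^+ 2 - (n + 1) * alpha + (n + 3) / 4 - 1 / 4 =
  n * ((alpha - 1 / 2) * (alpha - (1 / 2 + 1 / n))) by field.
rewrite pmulr_rge0; last by lra.
have i0 : 0 < 1 / n by rewrite div1r invr_gt0; lra.
set ni := 1 / n in i0 *.
have [al|al] := leP alpha (1 / 2) => /=.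
  by apply/esym; apply: mulr_le0; lra.
by rewrite pmulr_rge0 ?subr_ge0// subr_gt0.
Qed.

Let coef i := Num.sqrt (m.+1%:R / (2 ^+ m.-1 * omega m.+1) * energy i) *
    h `^ (m.+1%:R * alpha - (m.+1%:R + 3) / 2).

(** The upper bound comes from the largest energy; testing the i0-th component
    alone shows that it is attained. *)
Lemma sharp_grad i0 : (forall i, energy i <= energy i0) ->
  sharp_coef (fun v => enorm (grad (weighted v) x)) (coef i0).
Proof.
move=> le_energy; rewrite /coef -grad_coefE; split.
  move=> v g vg; apply: grad_bound => // i.
  rewrite /N ler_wpM2r ?invr_ge0 ?exprn_ge0 ?(ltW h0)//.
  by apply: ler_wpM2l => //; rewrite ltW// divr_gt0// mass_gt0.
move=> C; apply: partial_sharp => v g _.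
by have := coord_le_enorm (grad (weighted v) x) i0; rewrite mxE.
Qed.

Lemma sharp_partial i :
  sharp_coef (fun v => `|partial i (weighted v) x|) (coef i).
Proof.
rewrite /coef -grad_coefE; split; first by move=> v g vg; exact: partial_bound.
by move=> C; exact: partial_sharp.
Qed.

End sharp.

Theorem corollary3 (R : realType) (n : nat) (hn : (3 <= n)%N)
    (alpha : R) (halpha : 0 <= alpha)
    (x : 'rV[R]_n.-1.+1) (hx : half_space x) :
  let weighted (v : 'rV[R]_n.-1.+1 -> R) :=
    fun z : 'rV[R]_n.-1.+1 => z 0 ord_max `^ (n%:R * alpha - 1) * v z in
  let coef := sharp_const n alpha *
    x 0 ord_max `^ (n%:R * alpha - (n%:R + 3) / 2) in
  [/\ sharp_coef (fun v => enorm (grad (weighted v) x)) coef,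
      sharp_const n (1 : R) =
        Num.sqrt (n%:R * (n%:R - 1) / (2 ^+ n * omega n)) &
      alpha_cond n alpha ->
        sharp_coef (fun v => `|partial ord_max (weighted v) x|) coef].
Proof.
case: n hn x hx => // m m1 x hx weighted coef.
have condE := alpha_cond_energy m1 halpha.
have energy_max : @energy R m alpha ord_max = m.+1%:R * alpha ^+ 2 -
    (m.+1%:R + 1) * alpha + (m.+1%:R + 3) / 4 by rewrite /energy eqxx.
have normal_coef : alpha_cond m.+1 alpha ->
  sharp_const m.+1 alpha =
    Num.sqrt (m.+1%:R / (2 ^+ m.-1 * omega m.+1) *
              energy alpha (ord_max : 'I_m.+1)).
  by rewrite /sharp_const energy_max subSS subn1 => ->.
split; last first.
- by move=> cnd; rewrite /coef normal_coef//; exact: sharp_partial.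
- rewrite /sharp_const ifT; last first.
    rewrite (alpha_cond_energy m1 ler01) /energy eqxx.
    have : 3 <= m.+1%:R :> R by rewrite ler_nat.
    by lra.
  congr Num.sqrt; rewrite subSS subn1 -[in 2 ^+ m.+1](prednK (ltnW m1)) !exprS.
  move: (omega m.+1 : R) => w; rewrite !invfM; move: w^-1 => wi; field.
  by rewrite expf_neq0.
have [cnd|ncnd] := boolP (alpha_cond m.+1 alpha).
  rewrite /coef normal_coef//; apply: sharp_grad => // i.
  move: cnd; rewrite condE; case: (eqVneq i ord_max) => [->//|ni].
  by rewrite {2}/energy (negbTE ni).
(* As m > 0, index 0 is tangential, and the tangential energy is now the largest. *)
pose i0 : 'I_m.+1 := ord0.
have ni0 : (i0 == ord_max) = false by rewrite -val_eqE/= ltn_eqF// ltnW.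
have q0 : @energy R m alpha i0 = 1 / 4 by rewrite /energy ni0.
have -> : coef = Num.sqrt (m.+1%:R / (2 ^+ m.-1 * omega m.+1) * energy alpha i0) *
    x 0 ord_max `^ (m.+1%:R * alpha - (m.+1%:R + 3) / 2).
  rewrite /coef /sharp_const (negbTE ncnd) q0; congr (Num.sqrt _ * _).
  rewrite -[in 2 ^+ m.+1](prednK (ltnW m1)) !exprS.
  move: (omega m.+1 : R) => w; rewrite !invfM; move: w^-1 => wi; field.
  by rewrite expf_neq0.
apply: sharp_grad => // i; rewrite q0.
move: ncnd; rewrite condE -ltNge => /ltW.
by case: (eqVneq i ord_max) => [->//|ni] _; rewrite /energy (negbTE ni).
Qed.
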